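(* Let $(M,g,\nabla)$ be a compact statistical manifold. For an arbitrary number $L\in\mathbb{R}$ there exists a sufficiently small radius $r>0$ such that the norm of the second fundamental form of the sphere bundle $S^rM$ in $TM$ is greater than $L$ everywhere on $S^rM$.
   Context: All objects are smooth. A statistical manifold $(M,g,\nabla)$ is a manifold $M$ with a (positive definite) Riemannian metric $g$ and a torsion-free affine connection $\nabla$ such that $(\nabla_Xg)(Y,Z)=(\nabla_Yg)(X,Z)$ for all $X,Y,Z$. Let $\pi:TM\to M$ be the tangent bundle. For $\xi,X\in T_pM$: the vertical lift $X^v_\xi\in T_\xi TM$ is the velocity at $t=0$ of the curve $t\mapsto \xi+tX$; the horizontal lift $X^h_\xi\in T_\xi TM$ is the velocity at $t=0$ of the curve $t\mapsto\xi_t$ obtained by $\nabla$-parallel transport of $\xi$ along the $\nabla$-geodesic with initial velocity $X$. One has $T_\xi TM=\{X^v_\xi\}\oplus\{X^h_\xi\}$, both lifts being linear and injective in $X$. $TM$ is equipped with the Sasakian metric $\tilde g$ determined by $g$ and $\nabla$: the Riemannian metric with $\tilde g(X^v,Y^v)=g(X,Y)=\tilde g(X^h,Y^h)$ and $\tilde g(X^v,Y^h)=0$. For $r>0$, $S^rM=\{\xi\in TM:\ g(\xi,\xi)=r^2\}$, a hypersurface of $(TM,\tilde g)$ equipped with the induced metric. Its second fundamental form is $\mathfrak h(A,B)=\tilde g(\nabla^{\tilde g}_AB,\mathcal N)$, where $\nabla^{\tilde g}$ is the Levi-Civita connection of $\tilde g$ and $\mathcal N$ is a unit normal field; $\|\mathfrak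 h\|$ is its tensor norm with respect to the induced metric.
   Formalization: The formal theorem assumes that the dimension of M is not 1, since the claim fails there: for the flat circle, the sphere bundle consists of two closed geodesics of a flat cylinder, so its second fundamental form vanishes for every r. *)

(* Defs.v *)
From HB Require Import structures.
From mathcomp Require Import all_boot all_order all_algebra.
From mathcomp Require Import all_classical all_reals all_analysis.
Set Implicit Arguments.
Unset Strict Implicit.
Unset Printing Implicit Defensive.
Import Order.TTheory GRing.Theory Num.Theory.
Import numFieldNormedType.Exports.
Local Open Scope classical_set_scope.
Local Open Scope ring_scope.

(* Intended for open A.  In finite dimension, continuity of all iterated
   directional derivatives along constant vectors is the usual C^k condition. *)
Fixpoint Ck_on (R : realType) (V W : normedModType R) (k : nat)
    (A : set V) (f : V -> W) : Prop :=
  (forall x, A x -> {for x, continuous f}) /\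
  match k with
  | 0%N => True
  | k'.+1 => forall v : V,
      (forall x, A x -> derivable f x v) /\ Ck_on k' A (fun x => 'D_v f x)
  end.

Definition smooth_on (R : realType) (V W : normedModType R)
    (A : set V) (f : V -> W) : Prop := forall k, Ck_on k A f.

(* The atlas need not be maximal: any smooth atlas determines the smooth
   structure.  [chart_inv i] is only meaningful on the image of chart i. *)
Record manifold (R : realType) (n : nat) := Manifold {
  carrier :> topologicalType;
  manifold_hausdorff : hausdorff_space carrier;
  manifold_second_countable : @second_countable carrier;
  chart_index : Type;
  chart_dom : chart_index -> set carrier;
  chart : chart_index -> carrier -> 'rV[R]_n;
  chart_inv : chart_index -> 'rV[R]_n -> carrier;
  chart_dom_open : forall i, open (chart_dom i);
  chart_cover : forall p, exists i, chart_dom i p;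
  chart_image_open : forall i, open (chart i @` chart_dom i);
  chartK : forall i p, chart_dom i p -> chart_inv i (chart i p) = p;
  chart_continuous : forall i p,
    chart_dom i p -> {for p, continuous (chart i)};
  chart_inv_continuous : forall i x,
    (chart i @` chart_dom i) x -> {for x, continuous (chart_inv i)};
  chart_smooth : forall i j,
    smooth_on (chart i @` (chart_dom i `&` chart_dom j))
              (chart j \o chart_inv i)
}.

(* The coordinate domains of an atlas with their transition maps: the manifold
   is the disjoint union of the cdom i, with x in overlap i j glued to
   trans i j x.  Tensor fields and connections are compatible families of
   local components on the cdom i. *)
Record coordinates (R : realType) (n : nat) := Coordinates {
  cindex : Type;
  cdom : cindex -> set 'rV[R]_n;
  overlap : cindex -> cindex -> set 'rV[R]_n;
  trans : cindex -> cindex -> 'rV[R]_n -> 'rV[R]_n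
}.

Definition coords (R : realType) (n : nat) (M : manifold R n) :
    coordinates R n :=
  @Coordinates R n (chart_index M)
    (fun i => chart i @` @chart_dom R n M i)
    (fun i j => chart i @` (@chart_dom R n M i `&` chart_dom j))
    (fun i j => chart j \o chart_inv i).

(* Natural coordinates z = (x, y) of TM induced by a chart of M: x are the
   coordinates of the base point and y the components of the tangent vector. *)
Definition tangent_coords (R : realType) (n : nat) (C : coordinates R n) :
    coordinates R (n + n) :=
  @Coordinates R (n + n) (cindex C)
    (fun i => [set z | @cdom R n C i (lsubmx z)])
    (fun i j => [set z | @overlap R n C i j (lsubmx z)])
    (fun i j z => row_mx (trans i j (lsubmx z))
                         ('D_(rsubmx z) (trans i j) (lsubmx z))).

Definition inner (R : realType) (n : nat) (A : 'M[R]_n) (u v : 'rV[R]_n) : R :=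
  (u *m A *m v^T) 0 0.

Definition metric_field (R : realType) (n : nat) (C : coordinates R n) :=
  cindex C -> 'rV[R]_n -> 'M[R]_n.

Definition riemannian_metric (R : realType) (n : nat) (C : coordinates R n)
    (g : metric_field C) : Prop :=
  [/\ forall i, smooth_on (cdom i) (g i),
      forall i x, cdom i x -> (g i x)^T = g i x,
      forall i x v, cdom i x -> v != 0 -> 0 < inner (g i x) v v &
      forall i j x u v, overlap i j x ->
        inner (g i x) u v =
        inner (g j (trans i j x)) ('D_u (trans i j) x) ('D_v (trans i j) x)].

(* D i x u v has components Gamma^k_ab(x) u^a v^b, that is, it is nabla_u V
   for the vector field V with constant components v in chart i. *)
Definition connection_field (R : realType) (n : nat) (C : coordinates R n) :=
  cindex C -> 'rV[R]_n -> 'rV[R]_n -> 'rV[R]_n -> 'rV[R]_n.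

(* The last clause is the transformation law of Christoffel symbols. *)
Definition affine_connection (R : realType) (n : nat) (C : coordinates R n)
    (D : connection_field C) : Prop :=
  [/\ forall i u v, smooth_on (cdom i) (fun x => D i x u v),
      forall i x a u u' v, cdom i x ->
        D i x (a *: u + u') v = a *: D i x u v + D i x u' v,
      forall i x a u v v', cdom i x ->
        D i x u (a *: v + v') = a *: D i x u v + D i x u v' &
      forall i j x u v, overlap i j x ->
        'D_(D i x u v) (trans i j) x =
        'D_u (fun x' => 'D_v (trans i j) x') x +
        D j (trans i j x) ('D_u (trans i j) x) ('D_v (trans i j) x)].

(* Covariant derivative at x, in direction u, of the vector field Y. *)
Definition cov (R : realType) (n : nat)
    (D : 'rV[R]_n -> 'rV[R]_n -> 'rV[R]_n -> 'rV[R]_n)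
    (x u : 'rV[R]_n) (Y : 'rV[R]_n -> 'rV[R]_n) : 'rV[R]_n :=
  'D_u Y x + D x u (Y x).

(* nabla_X Y - nabla_Y X - [X, Y] in components. *)
Definition torsion_free (R : realType) (n : nat) (C : coordinates R n)
    (D : connection_field C) : Prop :=
  forall i x u v, cdom i x -> D i x u v = D i x v u.

(* (nabla_u g)(v, w) *)
Definition cov_metric (R : realType) (n : nat)
    (D : 'rV[R]_n -> 'rV[R]_n -> 'rV[R]_n -> 'rV[R]_n)
    (g : 'rV[R]_n -> 'M[R]_n) (x u v w : 'rV[R]_n) : R :=
  'D_u (fun x' => inner (g x') v w : R^o) x
  - inner (g x) (D x u v) w - inner (g x) v (D x u w).

Definition statistical_structure (R : realType) (n : nat)
    (C : coordinates R n) (g : metric_field C) (D : connection_field C) :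
    Prop :=
  [/\ riemannian_metric g, affine_connection D, torsion_free D &
      forall i x u v w, cdom i x ->
        cov_metric (D i) (g i) x u v w = cov_metric (D i) (g i) x v u w].

Definition levi_civita (R : realType) (n : nat) (C : coordinates R n)
    (g : metric_field C) (D : connection_field C) : Prop :=
  [/\ affine_connection D, torsion_free D &
      forall i x u v w, cdom i x -> cov_metric (D i) (g i) x u v w = 0].

(* Covariant derivative of the vector field Y along the curve c. *)
Definition cov_along (R : realType) (n : nat)
    (D : 'rV[R]_n -> 'rV[R]_n -> 'rV[R]_n -> 'rV[R]_n)
    (c Y : R -> 'rV[R]_n) (t : R) : 'rV[R]_n :=
  derive1 Y t + D (c t) (derive1 c t) (Y t).

Definition vlift (R : realType) (n : nat) (x y X : 'rV[R]_n) :
    'rV[R]_(n + n) :=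
  derive1 (fun t : R => row_mx x (y + t *: X)) 0.

(* W is the velocity at t = 0 of the curve Y in TM (over c) obtained by
   parallel transport of (x, y) along the geodesic c with velocity X at x. *)
Definition is_hlift (R : realType) (n : nat) (C : coordinates R n)
    (D : connection_field C) (i : cindex C) (x y X : 'rV[R]_n)
    (W : 'rV[R]_(n + n)) : Prop :=
  exists (eps : R) (c Y : R -> 'rV[R]_n),
    [/\ 0 < eps,
        smooth_on (ball (0 : R^o) eps) c /\ smooth_on (ball (0 : R^o) eps) Y,
        [/\ c 0 = x, derive1 c 0 = X & Y 0 = y],
        forall t, ball (0 : R^o) eps t ->
          [/\ cdom i (c t),
              cov_along (D i) c (derive1 c) t = 0 &
              cov_along (D i) c Y t = 0] &
        W = derive1 (fun t => row_mx (c t) (Y t)) 0].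

(* hl i x y X is the horizontal lift of X to the point (x, y) of TM. *)
Definition horizontal_lift (R : realType) (n : nat) (C : coordinates R n)
    (D : connection_field C)
    (hl : cindex C -> 'rV[R]_n -> 'rV[R]_n -> 'rV[R]_n -> 'rV[R]_(n + n)) :
    Prop :=
  forall i x y X, cdom i x -> is_hlift D i x y X (hl i x y X).

Definition sasakian_metric (R : realType) (n : nat) (C : coordinates R n)
    (g : metric_field C)
    (hl : cindex C -> 'rV[R]_n -> 'rV[R]_n -> 'rV[R]_n -> 'rV[R]_(n + n))
    (G : metric_field (tangent_coords C)) : Prop :=
  riemannian_metric G /\
  forall (i : cindex C) (x y X Y : 'rV[R]_n), cdom i x ->
    [/\ inner (G i (row_mx x y)) (vlift x y X) (vlift x y Y)
          = inner (g i x) X Y,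
        inner (G i (row_mx x y)) (hl i x y X) (hl i x y Y)
          = inner (g i x) X Y &
        inner (G i (row_mx x y)) (vlift x y X) (hl i x y Y) = 0].

Definition sphere_bundle (R : realType) (n : nat) (C : coordinates R n)
    (g : metric_field C) (r : R) (i : cindex C) : set 'rV[R]_(n + n) :=
  [set z | cdom i (lsubmx z) /\
           inner (g i (lsubmx z)) (rsubmx z) (rsubmx z) = r ^+ 2].

(* Velocities at t = 0 of the curves in S starting at z. *)
Definition tangent_space (R : realType) (m : nat) (S : set 'rV[R]_m)
    (z : 'rV[R]_m) : set 'rV[R]_m :=
  [set v | exists (eps : R) (c : R -> 'rV[R]_m),
    [/\ 0 < eps, smooth_on (ball (0 : R^o) eps) c, c 0 = z,
        forall t, ball (0 : R^o) eps t -> S (c t) & derive1 c 0 = v]].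

Definition unit_normal (R : realType) (m : nat) (G : 'rV[R]_m -> 'M[R]_m)
    (S : set 'rV[R]_m) (z N : 'rV[R]_m) : Prop :=
  inner (G z) N N = 1 /\ forall v, tangent_space S z v -> inner (G z) N v = 0.

(* h is the second fundamental form at z of the hypersurface S, with respect
   to the unit normal N at z, in an ambient space with metric G and connection
   D.  The field B is tangent to S at the points of S, and defined near z;
   only its values on S matter for the derivative along a tangent vector. *)
Definition second_fundamental_form (R : realType) (m : nat)
    (G : 'rV[R]_m -> 'M[R]_m)
    (D : 'rV[R]_m -> 'rV[R]_m -> 'rV[R]_m -> 'rV[R]_m)
    (S : set 'rV[R]_m) (z N : 'rV[R]_m) (h : 'rV[R]_m -> 'rV[R]_m -> R) :
    Prop :=
  let T := tangent_space S z in
  [/\ forall a u u' v, T u -> T u' -> T v ->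
        h (a *: u + u') v = a * h u v + h u' v,
      forall a u v v', T u -> T v -> T v' ->
        h u (a *: v + v') = a * h u v + h u v' &
      forall (U : set 'rV[R]_m) (B : 'rV[R]_m -> 'rV[R]_m) (a : 'rV[R]_m),
        open U -> U z -> smooth_on U B ->
        (forall z', U z' -> S z' -> tangent_space S z' (B z')) ->
        T a -> h a (B z) = inner (G z) (cov D z a B) N].

Definition orthonormal_basis (R : realType) (m k : nat) (A : 'M[R]_m)
    (T : set 'rV[R]_m) (e : 'I_k -> 'rV[R]_m) : Prop :=
  [/\ forall i, T (e i),
      forall i j, inner A (e i) (e j) = (i == j)%:R &
      forall v, T v -> exists a : 'I_k -> R, v = \sum_i a i *: e i].

(* The tensor norm of a bilinear form, computed in an orthonormal basis e. *)
Definition tensor_norm (R : realType) (m k : nat) (e : 'I_k -> 'rV[R]_m)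
    (h : 'rV[R]_m -> 'rV[R]_m -> R) : R :=
  Num.sqrt (\sum_i \sum_j h (e i) (e j) ^+ 2).

(* Main.v *)
Require Import Defs.
From HB Require Import structures.
From mathcomp Require Import all_boot all_order all_algebra.
From mathcomp Require Import all_classical all_reals all_analysis.
From mathcomp Require Import ring lra.
Import Order.TTheory GRing.Theory Num.Theory.
Import numFieldNormedType.Exports.
Local Open Scope classical_set_scope.
Local Open Scope ring_scope.

(** Write C(X, Y, Z) for the cubic tensor (nabla_X g)(Y, Z) of the statistical
    structure, and use the natural coordinates (x, y) of TM.  The horizontal
    lift of X at (x, y) is (X, - Gamma(X, y)), so the Sasakian metric pairs
    (X, V) and (X', V') to
      g(X, X') + g(V + Gamma(X, y), V' + Gamma(X', y))
    ([sasakian_metricE]).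

    Fix a point (x, y) of the sphere bundle of radius r, a unit normal N, and
    let Z be the horizontal part of N.  As N is orthogonal to the vertical
    vectors tangent to the sphere of radius r of the fibre, its vertical part
    is lambda y for a scalar lambda.  Orthogonality to the remaining tangent
    vectors gives 2 g(Z, X) = lambda C(X, y, y) for every X
    ([normal_horizontal_part]), and the normalization of N reads
    g(Z, Z) + lambda^2 r^2 = 1.  Since n is not 1, there is a unit vector u of
    the fibre orthogonal to y.  Rotating u towards y inside the fibre, and
    using the Koszul formula for the Levi-Civita connection of the Sasakian
    metric, one finds ([second_fundamental_form_vertical])
      h(u^v, u^v) = - lambda - C(Z, u, u) / 2.

    The tensor C is continuous and independent of the chart, so on a compact
    manifold C(X, v, v)^2 <= K g(X, X) g(v, v)^2 for a constant K
    ([compact_cubic_bound]).  The formula for g(Z, X) then shows that Z is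
    small compared with lambda y as soon as K r^2 <= 1, hence
    |lambda| >= 1 / (2 r), whereas |C(Z, u, u)| <= K.  The norm of h is at least
    |h(u^v, u^v)|, because u^v has length 1 ([sqr_form_le_tensor]).  So it is at
    least 1 / (2 r) - K, uniformly on the sphere bundle, which is larger than L
    for small r ([tensor_norm_lower_bound]). *)

Set Implicit Arguments.
Unset Strict Implicit.
Unset Printing Implicit Defensive.

(** * Directional derivatives *)

(** Reduces directional derivatives to derivatives of functions of one real
    variable: the difference quotients on both sides are the same. *)
Lemma is_derive_lineP (R : realType) (V W : normedModType R)
    (f : V -> W) (x v : V) (t : R^o) (d : W) :
  is_derive (t *: v + x) v f d <->
  is_derive t (1 : R^o) (fun h : R^o => f (h *: v + x)) d.
Proof.
have e : (fun h : R =>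
    h^-1 *: ((f \o shift (t *: v + x)) (h *: v) - f (t *: v + x))) =
  (fun h : R => h^-1 *: (((fun h : R^o => f (h *: v + x)) \o shift t)
                          (h *: (1 : R^o)) - f (t *: v + x))).
  by apply/funext => h /=; rewrite [_%:A]mulr1 scalerDl addrA.
by split=> -[dv <-]; split; rewrite /derivable /derive ?e // -?e.
Qed.

Lemma is_derive_along_line (R : realType) (V W : normedModType R)
    (f : V -> W) (x v : V) (d : W) :
  is_derive x v f d <-> is_derive (0 : R^o) 1 (fun h : R^o => f (h *: v + x)) d.
Proof. by have := is_derive_lineP f x v 0 d; rewrite scale0r add0r. Qed.

(** On the line through [x] the inner function becomes a function of one real
    variable, for which derivability and differentiability agree. *)
Lemma is_derive_chain (R : realType) (U V W : normedModType R)
    (c : U -> V) (f : V -> W) (x v : U) (c' : V) :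
  is_derive x v c c' -> differentiable f (c x) ->
  is_derive x v (f \o c) ('D_c' f (c x)).
Proof.
move=> /is_derive_along_line dc df; apply/is_derive_along_line.
have dc1 : differentiable (fun h : R^o => c (h *: v + x)) (0 : R^o).
  exact/derivable1_diffP.
have df1 : differentiable f (c ((0 : R^o) *: v + x)) by rewrite scale0r add0r.
have -> : (fun h : R^o => (f \o c) (h *: v + x)) =
          f \o (fun h : R^o => c (h *: v + x)) by [].
split; first by apply/derivable1_diffP; exact: differentiable_comp.
rewrite deriveE; last exact: differentiable_comp.
rewrite diff_comp //=; case: dc => _ <-; rewrite (deriveE _ dc1).
by rewrite deriveE // scale0r add0r.
Qed.

Lemma is_derive_scale_dir (R : realType) (V W : normedModType R)
    (f : V -> W) (x v : V) (k : R) (d : W) :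
  is_derive x v f d -> is_derive x (k *: v) f (k *: d).
Proof.
move=> /is_derive_along_line df; apply/is_derive_along_line.
have dk : is_derive (0 : R^o) 1 (fun h : R^o => h * k : R^o) k.
  rewrite (_ : (fun h : R^o => _) = k *: (id : R^o -> R^o)); last first.
    by apply/funext => h; rewrite /= mulrC.
  by apply: is_derive_eq; rewrite [_ *: _]mulr1.
have df0 : differentiable (fun h : R^o => f (h *: v + x)) ((0 : R^o) * k : R^o).
  by rewrite mul0r; exact/derivable1_diffP.
have := @is_derive_chain _ _ _ _ (fun h : R^o => h * k : R^o) _ _ _ _ dk df0.
rewrite (_ : (fun h : R^o => f (h *: v + x)) \o _ =
   (fun h : R^o => f (h *: (k *: v) + x))); last first.
  by apply/funext => h /=; rewrite scalerA.
move=> H; apply: (is_derive_eq H).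
rewrite mul0r deriveE; last exact/derivable1_diffP.
rewrite -[k in LHS]mulr1 -[k * 1]/(k *: (1 : R^o)) linearZ; congr (_ *: _).
rewrite -deriveE; last exact/derivable1_diffP.
exact: derive_val.
Qed.

Lemma is_derive_mxP (R : realType) (V : normedModType R) (m n : nat)
    (A : V -> 'M[R]_(m, n)) (x v : V) (A' : 'M[R]_(m, n)) :
  is_derive x v A A' <->
  forall i j, is_derive x v (fun y => A y i j : R^o) (A' i j).
Proof.
split=> [[dA <-] i j|dA].
  split; first exact: (derivable_mxP _ _ _).1.
  by rewrite derive_mx // mxE.
have dA1 : derivable A x v by apply/derivable_mxP => i j; case: (dA i j).
split=> //; rewrite derive_mx //; apply/matrixP => i j; rewrite mxE.
by case: (dA i j).
Qed.

Lemma is_derive_mulmx (R : realType) (V : normedModType R) (m n p : nat)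
    (A : V -> 'M[R]_(m, n)) (B : V -> 'M[R]_(n, p)) (x v : V)
    (A' : 'M[R]_(m, n)) (B' : 'M[R]_(n, p)) :
  is_derive x v A A' -> is_derive x v B B' ->
  is_derive x v (fun y => A y *m B y) (A' *m B x + A x *m B').
Proof.
move=> /is_derive_mxP dA /is_derive_mxP dB; apply/is_derive_mxP => i j.
have dAB k : is_derive x v ((fun y => A y i k : R^o) * (fun y => B y k j : R^o))
    (A x i k *: B' k j + B x k j *: A' i k).
  by apply: is_deriveM.
have := is_derive_sum dAB; rewrite (_ : \sum_k _ = fun y => (A y *m B y) i j).
  move=> H; apply: (is_derive_eq H).
  rewrite !mxE -big_split /=; apply: eq_bigr => k _.
  by rewrite addrC -![_ *: _]/(_ * _); congr (_ + _); rewrite mulrC.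
by apply/funext => y; rewrite mxE fct_sumE.
Qed.

Lemma is_derive_inner (R : realType) (V : normedModType R) (n : nat)
    (A : V -> 'M[R]_n) (a b : V -> 'rV[R]_n) (x v : V)
    (A' : 'M[R]_n) (a' b' : 'rV[R]_n) :
  is_derive x v A A' -> is_derive x v a a' -> is_derive x v b b' ->
  is_derive x v (fun y => inner (A y) (a y) (b y) : R^o)
    (inner A' (a x) (b x) + inner (A x) a' (b x) + inner (A x) (a x) b').
Proof.
move=> dA da db; rewrite /inner.
have dbT : is_derive x v (fun y => (b y)^T) b'^T.
  apply/is_derive_mxP => i j; move/is_derive_mxP/(_ j i): db.
  by rewrite mxE; congr is_derive; apply/funext => y; rewrite mxE.
have /is_derive_mxP/(_ 0 0) := is_derive_mulmx (is_derive_mulmx da dA) dbT.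
move=> H; apply: (is_derive_eq H).
by rewrite mulmxDl !mxE; congr (_ + _); rewrite addrC.
Qed.

(** * Functions of class C^k *)

Section Ck.
Context {R : realType}.
Implicit Types (V W : normedModType R).

(** The set has to be open because the derivatives at a point see a whole
    neighbourhood of it. *)
Lemma Ck_on_ext V W (k : nat) (A : set V) (f g : V -> W) :
  open A -> (forall x, A x -> f x = g x) -> Ck_on k A f -> Ck_on k A g.
Proof.
move=> oA; elim: k f g => [|k IH] f g fg [cf df].
all: have nfg x : A x -> {near x, f =1 g}
  by move=> Ax; apply: filterS (open_nbhs_nbhs (conj oA Ax)) => y; exact: fg.
all: have cg x : A x -> {for x, continuous g}
  by move=> Ax; rewrite /prop_for /continuous_at -fg //;
     apply: cvg_trans (cf _ Ax); apply: near_eq_cvg; exact: nfg.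
  by split.
split=> [//|v]; have [dv Cv] := df v; split=> [x Ax|].
  exact: near_eq_derivable (nfg _ Ax) (dv _ Ax).
by apply: IH Cv => x Ax; apply: near_eq_derive; exact: nfg.
Qed.

Lemma Ck_on_subset V W k (A B : set V) (f : V -> W) :
  A `<=` B -> Ck_on k B f -> Ck_on k A f.
Proof.
move=> AB; elim: k f => [|k IH] f [cf df]; split=> //.
- by move=> x /AB; exact: cf.
- by move=> x /AB; exact: cf.
- move=> v; have [dv Cv] := df v; split; last exact: IH.
  by move=> x /AB; exact: dv.
Qed.

Lemma Ck_onW V W k (A : set V) (f : V -> W) : Ck_on k.+1 A f -> Ck_on k A f.
Proof.
elim: k f => [|k IH] f [cf df]; split=> // v.
by have [dv Cv] := df v; split=> //; exact: IH.
Qed.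

Lemma Ck_on_cst V W k (A : set V) (w : W) : Ck_on k A (fun=> w).
Proof.
elim: k w => [|k IH] w; split=> //; try by move=> x _; exact: cst_continuous.
move=> v; split=> [x _|]; first exact: derivable_cst.
have -> : (fun x => 'D_v (fun=> w) x) = (fun=> 0 : W).
  by apply/funext => x; exact: derive_cst.
exact: IH.
Qed.

Lemma Ck_onD V W k (A : set V) (f g : V -> W) : open A ->
  Ck_on k A f -> Ck_on k A g -> Ck_on k A (fun x => f x + g x).
Proof.
move=> oA; elim: k f g => [|k IH] f g [cf df] [cg dg]; split=> //;
  try by move=> x Ax; apply: cvgD; [exact: cf|exact: cg].
move=> v; have [dvf Cf] := df v; have [dvg Cg] := dg v; split=> [x Ax|].
  by apply: derivableD; [exact: dvf|exact: dvg].
apply: Ck_on_ext oA _ (IH _ _ Cf Cg) => x Ax; apply/esym/deriveD.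
  exact: dvf.
exact: dvg.
Qed.

Lemma Ck_onM V k (A : set V) (f g : V -> R^o) : open A ->
  Ck_on k A f -> Ck_on k A g -> Ck_on k A (fun x => f x * g x : R^o).
Proof.
move=> oA; elim: k f g => [|k IH] f g Cf Cg; move: (Cf) (Cg) => [cf df] [cg dg];
  split=> //; try by move=> x Ax; apply: cvgM; [exact: cf|exact: cg].
move=> v; have [dvf Cvf] := df v; have [dvg Cvg] := dg v; split=> [x Ax|].
  by apply: derivableM; [exact: dvf|exact: dvg].
have C1 := IH _ _ (Ck_onW Cf) Cvg; have C2 := IH _ _ (Ck_onW Cg) Cvf.
apply: Ck_on_ext oA _ (Ck_onD oA C1 C2) => x Ax; apply/esym/deriveM.
  exact: dvf.
exact: dvg.
Qed.

Lemma Ck_on_sum V W k (A : set V) (n : nat) (f : 'I_n -> V -> W) : open A ->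
  (forall i, Ck_on k A (f i)) -> Ck_on k A (fun x => \sum_i f i x).
Proof.
move=> oA Cf; elim: n f Cf => [|n IH] f Cf.
  rewrite (_ : (fun x => _) = fun=> 0); first exact: Ck_on_cst.
  by apply/funext => x; rewrite big_ord0.
rewrite (_ : (fun x => _) =
   fun x => f ord0 x + \sum_(i < n) f (lift ord0 i) x).
  by apply: Ck_onD => //; exact: IH.
by apply/funext => x; rewrite big_ord_recl.
Qed.

Lemma Ck_on_mxP V k (A : set V) m n (M : V -> 'M[R]_(m, n)) : open A ->
  Ck_on k A M <-> forall i j, Ck_on k A (fun x => M x i j : R^o).
Proof.
move=> oA; have cP (N : V -> 'M[R]_(m, n)) x : {for x, continuous N} <->
    forall i j, {for x, continuous (fun y => N y i j : R^o)}.
  split=> [cN i j|cN].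
    apply: (@continuous_comp _ _ _ N (fun B : 'M[R]_(m, n) => B i j) _ cN).
    exact: coord_continuous.
  apply/cvg_mx_entourageP => E entE; near=> y => i j; rewrite inE.
  move: i j; near: y; apply: filter_forall => i; apply: filter_forall => j.
  by have /cvg_entourageP := cN i j; apply.
elim: k M => [|k IH] M; split.
- by move=> [cM _] i j; split=> // x Ax; apply: (cP _ _).1; exact: cM.
- move=> cM; split=> // x Ax; apply/cP => i j.
  by case: (cM i j) => H _; exact: H.
- move=> [cM dM] i j; split=> [x Ax|v].
    by apply: (cP _ _).1; exact: cM.
  have [dv Cv] := dM v; split=> [x Ax|].
    exact: ((derivable_mxP _ _ _).1 (dv _ Ax)).
  move/IH/(_ i j): Cv; apply: Ck_on_ext oA _ => x Ax.
  by rewrite derive_mx ?mxE //; exact: dv.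
- move=> CM; split=> [x Ax|v].
    by apply/cP => i j; case: (CM i j) => H _; exact: H.
  have dv x : A x -> derivable M x v.
    move=> Ax; apply/derivable_mxP => i j; case: (CM i j) => _ /(_ v) [H _].
    exact: H.
  split=> //; apply/IH => i j; case: (CM i j) => _ /(_ v) [_].
  by apply: Ck_on_ext oA _ => x Ax; rewrite derive_mx ?mxE //; exact: dv.
Unshelve. all: by end_near. Qed.

Lemma Ck_on_mulmx V k (A : set V) m n p (M : V -> 'M[R]_(m, n))
    (N : V -> 'M[R]_(n, p)) : open A ->
  Ck_on k A M -> Ck_on k A N -> Ck_on k A (fun x => M x *m N x).
Proof.
move=> oA /(Ck_on_mxP _ _ oA) CM /(Ck_on_mxP _ _ oA) CN.
apply/(Ck_on_mxP _ _ oA) => i j.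
rewrite (_ : (fun x => _) = fun x => \sum_l (M x i l * N x l j : R^o)).
  by apply: Ck_on_sum => // l; apply: Ck_onM.
by apply/funext => x; rewrite mxE.
Qed.

(** For an affine map [p] with linear part [l], the difference quotients of
    the composition are exactly those of [f] along [l v]: its derivatives are
    again compositions of this form, which allows the induction. *)
Lemma Ck_on_comp_affine (U V W : normedModType R) k (A : set V) (f : V -> W)
    (p l : U -> V) : continuous p ->
  (forall x v (h : R), p (h *: v + x) = h *: l v + p x) ->
  Ck_on k A f -> Ck_on k (p @^-1` A) (f \o p).
Proof.
move=> cp pl; elim: k f => [|k IH] f [cf df]; split=> //;
  try by move=> x Ax; apply: continuous_comp; [exact: cp|exact: cf].
move=> v; have [dv Cv] := df (l v).
have e x : (fun h : R => h^-1 *: (((f \o p) \o shift x) (h *: v) - (f \o p) x))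
    = (fun h : R => h^-1 *: ((f \o shift (p x)) (h *: l v) - f (p x))).
  by apply/funext => h; rewrite /= pl.
split=> [x Ax|].
  by rewrite /derivable e; exact: dv.
rewrite (_ : (fun x => _) = (fun y => 'D_(l v) f y) \o p); first exact: IH.
by apply/funext => x; rewrite /derive /= -e.
Qed.

Lemma is_derive_invsqrt (x : R^o) : 0 < x ->
  is_derive x (1 : R^o) (fun y : R^o => (Num.sqrt y)^-1 : R^o)
    (- 2^-1 * (Num.sqrt x)^-1 ^+ 3).
Proof.
move=> x0; have sx0 : Num.sqrt x != 0 by rewrite gt_eqF // sqrtr_gt0.
have ds := is_derive1_sqrt x0.
split; first by apply: derivableV => //; case: ds.
rewrite (@deriveV _ _ (Num.sqrt : R^o -> R^o)) //.
rewrite derive_val -[_ *: _]/(_ * _); field.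
by rewrite sx0.
Qed.

Lemma is_derive_invsqrt_comp V (s : V -> R^o) (x v : V) (s' : R) :
  0 < s x -> is_derive x v s s' ->
  is_derive x v (fun y => (Num.sqrt (s y))^-1 : R^o)
    (- 2^-1 * s' * (Num.sqrt (s x))^-1 ^+ 3).
Proof.
move=> sx0 ds; have di := is_derive_invsqrt sx0.
have df : differentiable (fun y : R^o => (Num.sqrt y)^-1 : R^o) (s x).
  by apply/derivable1_diffP; case: di.
apply: (is_derive_eq (is_derive_chain ds df)).
have [_] := is_derive_scale_dir s' di.
rewrite -[s' *: (1 : R^o)]/(s' * 1) mulr1 => ->.
by rewrite -[_ *: _]/(_ * _) mulrCA mulrA.
Qed.

(** The derivative of s^(-1/2) is - s' (s^(-1/2))^3 / 2, a product of functions
    that are one order less regular: this is what makes the induction work. *)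
Lemma Ck_on_invsqrt V k (A : set V) (s : V -> R^o) : open A ->
  (forall x, A x -> 0 < s x) ->
  Ck_on k A s -> Ck_on k A (fun x => (Num.sqrt (s x))^-1 : R^o).
Proof.
move=> oA s0; elim: k => [|k IH] Cs; move: (Cs) => [cs ds].
  split=> // x Ax; have sx0 : Num.sqrt (s x) != 0.
    by rewrite gt_eqF // sqrtr_gt0 s0.
  apply: cvgV => //.
  apply: (@continuous_comp _ _ _ s (@Num.sqrt R) _ (cs _ Ax)).
  exact: sqrt_continuous.
split.
  move=> x Ax; have sx0 : Num.sqrt (s x) != 0.
    by rewrite gt_eqF // sqrtr_gt0 s0.
  apply: cvgV => //.
  apply: (@continuous_comp _ _ _ s (@Num.sqrt R) _ (cs _ Ax)).
  exact: sqrt_continuous.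
move=> v; have [dv Cv] := ds v.
have D x : A x -> is_derive x v (fun y => (Num.sqrt (s y))^-1 : R^o)
    (- 2^-1 * 'D_v s x * (Num.sqrt (s x))^-1 ^+ 3).
  by move=> Ax; apply: is_derive_invsqrt_comp; [exact: s0|exact/derivableP/dv].
split=> [x /D [] //|].
have CI := IH (Ck_onW Cs).
have := Ck_onM oA (Ck_onM oA (Ck_on_cst k A (- 2^-1 : R^o)) Cv)
  (Ck_onM oA CI (Ck_onM oA CI CI)).
by apply: Ck_on_ext oA _ => x /D [_ ->]; rewrite !exprS expr0 mulr1.
Qed.

End Ck.

Section MatrixValued.
Context {R : realType}.
Implicit Types (V W : normedModType R).

Lemma is_derive_scalemx V m n (f : V -> R^o) (M : V -> 'M[R]_(m, n)) x v f' M' :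
  is_derive x v f f' -> is_derive x v M M' ->
  is_derive x v (fun y => f y *: M y) (f' *: M x + f x *: M').
Proof.
move=> df /is_derive_mxP dM; apply/is_derive_mxP => i j.
have H := is_deriveM df (dM i j).
rewrite (_ : (fun y => _) = f * (fun y => M y i j : R^o)); last first.
  by apply/funext => y; rewrite mxE.
apply: (is_derive_eq H).
by rewrite !mxE addrC -![_ *: _]/(_ * _) [M x i j * _]mulrC.
Qed.

Lemma is_derive_row_mx V m n1 n2 (M : V -> 'M[R]_(m, n1))
    (N : V -> 'M[R]_(m, n2)) x v M' N' :
  is_derive x v M M' -> is_derive x v N N' ->
  is_derive x v (fun y => row_mx (M y) (N y)) (row_mx M' N').
Proof.
move=> /is_derive_mxP dM /is_derive_mxP dN; apply/is_derive_mxP => i j.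
rewrite (_ : (fun y => _) = fun y =>
  match fintype.split j with inl l => M y i l | inr l => N y i l end : R^o);
    last first.
  by apply/funext => y; rewrite mxE.
by rewrite mxE; case: (fintype.split j) => l; [exact: dM|exact: dN].
Qed.

Lemma is_derive_line V (a b : V) (t : R^o) :
  is_derive t (1 : R^o) (fun s : R^o => s *: a + b) a.
Proof. exact: (is_derive_lineP id b a t a).1 (is_derive_id _ _). Qed.

Lemma continuous_line V (a b : V) : continuous (fun t : R^o => t *: a + b).
Proof.
move=> t; apply/differentiable_continuous/derivable1_diffP.
by case: (is_derive_line a b t).
Qed.

Lemma Ck_on_row_mx V k (A : set V) m n1 n2 (M : V -> 'M[R]_(m, n1))
    (N : V -> 'M[R]_(m, n2)) : open A ->
  Ck_on k A M -> Ck_on k A N -> Ck_on k A (fun y => row_mx (M y) (N y)).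
Proof.
move=> oA /(Ck_on_mxP _ _ oA) CM /(Ck_on_mxP _ _ oA) CN.
apply/(Ck_on_mxP _ _ oA) => i j.
rewrite (_ : (fun y => _) = fun y =>
  match fintype.split j with inl l => M y i l | inr l => N y i l end : R^o);
    last first.
  by apply/funext => y; rewrite mxE.
by case: (fintype.split j) => l.
Qed.

Lemma Ck_on_scalemx V k (A : set V) m n (f : V -> R^o) (M : V -> 'M[R]_(m, n)) :
  open A -> Ck_on k A f -> Ck_on k A M -> Ck_on k A (fun y => f y *: M y).
Proof.
move=> oA Cf /(Ck_on_mxP _ _ oA) CM.
apply/(Ck_on_mxP _ _ oA) => i j.
rewrite (_ : (fun y => _) = fun y => f y * M y i j : R^o); last first.
  by apply/funext => y; rewrite mxE.
exact: Ck_onM.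
Qed.

Lemma Ck_on_inner V k (A : set V) n (M : V -> 'M[R]_n) (u v : V -> 'rV[R]_n) :
  open A -> Ck_on k A M -> Ck_on k A u -> Ck_on k A v ->
  Ck_on k A (fun x => inner (M x) (u x) (v x) : R^o).
Proof.
move=> oA CM Cu Cv; rewrite /inner.
have CvT : Ck_on k A (fun x => (v x)^T).
  apply/(Ck_on_mxP _ _ oA) => i j; move/(Ck_on_mxP _ _ oA)/(_ j i): Cv.
  by congr Ck_on; apply/funext => y; rewrite mxE.
have := Ck_on_mulmx oA (Ck_on_mulmx oA Cu CM) CvT.
by move/(Ck_on_mxP _ _ oA)/(_ 0 0).
Qed.

Lemma Ck_on_id V k (A : set V) : Ck_on k A (id : V -> V).
Proof.
case: k => [|k]; split=> //; try by move=> x _; exact: cvg_id.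
move=> v; split=> [x _|]; first exact: derivable_id.
have -> : (fun x => 'D_v id x) = (fun=> v).
  by apply/funext => x; exact: derive_id.
exact: Ck_on_cst.
Qed.

Lemma Ck_on_comp_line V W k (A : set V) (f : V -> W) (a b : V) :
  Ck_on k A f ->
  Ck_on k [set t : R^o | A (t *: a + b)] (fun t : R^o => f (t *: a + b)).
Proof.
apply: (@Ck_on_comp_affine _ R^o V W k A f (fun t : R^o => t *: a + b)
  (fun t : R^o => t *: a)).
  exact: continuous_line.
by move=> t v h; rewrite scalerDl scalerA addrA.
Qed.

Lemma Ck_on_line V k (A : set R^o) (a b : V) :
  Ck_on k A (fun t : R^o => t *: a + b).
Proof.
apply: (@Ck_on_subset _ _ _ k _ [set t : R^o | setT (t *: a + b)]) => //.
by apply: (@Ck_on_comp_line V V k setT id); exact: Ck_on_id.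
Qed.

End MatrixValued.

(** * Functions of class C^1 are differentiable *)

(** Mean value theorem on the segment from [x] to [k *: v + x]. *)
Lemma MVT_along (R : realType) (V : normedModType R) (f : V -> R^o)
    (x v : V) (k : R) :
  (forall t : R, `|t| <= `|k| -> derivable f (t *: v + x) v) ->
  exists2 t : R, `|t| <= `|k| &
    f (k *: v + x) - f x = k * 'D_v f (t *: v + x).
Proof.
move=> df; pose phi (s : R^o) := f (s *: (k *: v) + x).
have ds s : s \in `[0, 1]%R ->
    is_derive (s : R^o) 1 phi (k * 'D_v f ((s * k) *: v + x)).
  rewrite in_itv /= => /andP[s0 s1].
  apply: (is_derive_lineP f x (k *: v) s _).1; rewrite scalerA.
  apply: (@is_derive_scale_dir _ _ _ f _ v k).
  by apply/derivableP/df; rewrite normrM ler_piMl // ger0_norm.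
have ds1 s : s \in `]0, 1[%R ->
    is_derive (s : R^o) 1 phi (k * 'D_v f ((s * k) *: v + x)).
  by rewrite in_itv /= => /andP[s0 s1]; apply: ds; rewrite in_itv /= !ltW.
have cphi : {within `[0, 1]%classic, continuous phi}.
  by apply: derivable_within_continuous => s /ds [].
have [s s01] := MVT_segment ler01 ds1 cphi.
rewrite /phi scale1r scale0r add0r subr0 mulr1 => e; exists (s * k) => //.
by move: s01; rewrite in_itv /= => /andP[s0 s1];
  rewrite normrM ler_piMl // ger0_norm.
Qed.

Lemma coord_le_norm (R : realType) n (v : 'rV[R]_n) j : `|v 0 j| <= `|v|.
Proof.
rewrite [leRHS]/Num.Def.normr /= mx_normrE; apply/bigmax_geP; right => /=.
by exists (0, j).
Qed.

Lemma norm_le_coord (R : realType) n (v : 'rV[R]_n) (c : R) : 0 <= c ->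
  (forall j, `|v 0 j| <= c) -> `|v| <= c.
Proof.
move=> c0 vc; rewrite [leLHS]/Num.Def.normr /= mx_normrE; apply/bigmax_leP.
by split=> // -[i j] _ /=; rewrite ord1.
Qed.

Lemma differentiable_of_approx (R : realType) (V W : normedModType R)
    (f : V -> W) (x : V) (L : {linear V -> W}) : continuous L ->
  (forall eps : R, 0 < eps ->
    \forall h \near (0 : V), `|f (h + x) - f x - L h| <= eps * `|h|) ->
  differentiable f x.
Proof.
move=> cL fL.
have Lo : f \o shift x = cst (f x) + L +o_ 0 id.
  apply/eqaddoP => eps eps0; apply: filterS (fL _ eps0) => h.
  by rewrite -addrA -opprD.
by apply/diff_locallyP; rewrite (diff_unique cL Lo).
Qed.

(** [Ck_on] only speaks of directional derivatives, whereas the chain rule for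
    the composition with a change of charts needs a total derivative.  The
    increment of [f] is split into increments along the coordinate axes; the
    mean value theorem turns each of them into a partial derivative at a nearby
    point, and these are continuous. *)
Lemma Ck_on_differentiable (R : realType) n (A : set 'rV[R]_n)
    (f : 'rV[R]_n -> R^o) x :
  open A -> Ck_on 1 A f -> A x -> differentiable f x.
Proof.
move=> oA [cf df] Ax; pose e (a : 'I_n) : 'rV[R]_n := delta_mx 0 a.
pose L (h : 'rV[R]_n) : R^o := \sum_a h 0 a * 'D_(e a) f x.
have Llin : linear L.
  move=> k u v; rewrite /L scaler_sumr -big_split /=; apply: eq_bigr => a _.
  by rewrite !mxE mulrDl -[_ *: _]/(_ * _) mulrA.
pose LM := GRing.isLinear.Build _ _ _ _ _ Llin.
pose LL : {linear 'rV[R]_n -> R^o} := HB.pack L LM.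
have cL : continuous LL.
  have -> : (LL : 'rV[R]_n -> R^o) =
      fun h => \sum_a ('D_(e a) f x * h 0 a : R^o).
    by apply/funext => h; apply: eq_bigr => a _; rewrite mulrC.
  move=> h; apply: (@cvg_big R^o _ +%R 0 xpredT add_continuous _ (nbhs h) _
    (fun a (h : 'rV[R]_n) => 'D_(e a) f x * h 0 a : R^o)) => a _.
  by apply: (@cvgMl_tmp R _ (nbhs h)); exact: coord_continuous.
apply: (differentiable_of_approx cL).
  move=> eps eps0.
  have cD a : {for x, continuous (fun y => 'D_(e a) f y)}.
    by have [_ [c _]] := df (e a); exact: c.
  have e'0 : 0 < eps / n.+1%:R by rewrite divr_gt0.
  have : \forall y \near x, A y /\ forall a,
      `|'D_(e a) f x - 'D_(e a) f y| <= eps / n.+1%:R.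
    near=> y; split; first by near: y; exact: open_nbhs_nbhs.
    near: y; apply: filter_forall => a.
    by have /cvgrPdist_le := cD a; apply.
  move=> /nbhs_ballP[d /= d0 dP].
  near=> h.
  have hd : `|h| < d.
    near: h; apply/nbhs_ballP; exists d => //= h.
    by rewrite -ball_normE /= sub0r normrN.
  (* [tr m] keeps the first m coordinates of h: the successive vertices of
     the broken line from 0 to h along the axes. *)
  pose tr m : 'rV[R]_n := \row_a (if (a < m)%N then h 0 a else 0).
  have trS (a : 'I_n) : tr a.+1 = h 0 a *: e a + tr a.
    apply/rowP => b; rewrite !mxE eqxx /= ltnS leq_eqVlt -val_eqE /=.
    case: eqP => [/val_inj ->|_] /=; last by rewrite mulr0 add0r.
    by rewrite ltnn mulr1 addr0.
  have step (a : 'I_n) :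
      `|f (tr a.+1 + x) - f (tr a + x) - h 0 a * 'D_(e a) f x|
      <= `|h| * (eps / n.+1%:R).
    have near_seg (t : R) : `|t| <= `|h 0 a| ->
        ball x d (t *: e a + (tr a + x)).
      move=> ta; rewrite -ball_normE /= addrA opprD addrCA subrr addr0.
      rewrite normrN; apply: le_lt_trans hd; apply: norm_le_coord => // b.
      rewrite !mxE eqxx /= -val_eqE /=; case: eqP => [/val_inj ->|_].
        by rewrite ltnn addr0 mulr1 (le_trans ta) // coord_le_norm.
      by rewrite mulr0 add0r; case: ifP => _; rewrite ?normr0 // coord_le_norm.
    rewrite trS -(addrA (h 0 a *: e a)).
    have [|t ta ->] := @MVT_along _ _ f (tr a + x) (e a) (h 0 a).
      by move=> t /near_seg/dP[At _]; case: (df (e a)) => + _; exact.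
    rewrite -mulrBr normrM ler_pM // ?coord_le_norm // distrC.
    by have [_] := dP _ (near_seg _ ta).
  change (`|f (h + x) - f x - L h| <= eps * `|h|).
  have -> : f (h + x) - f x - L h =
      \sum_(a < n) (f (tr a.+1 + x) - f (tr a + x) - h 0 a * 'D_(e a) f x).
    rewrite big_split /= sumrN; congr (_ - _).
    rewrite -(big_mkord xpredT (fun a => f (tr a.+1 + x) - f (tr a + x))).
    rewrite telescope_sumr //; congr (f _ - f _).
      by congr (_ + _); apply/rowP => a; rewrite mxE ltn_ord.
    by rewrite (_ : tr 0%N = 0) ?add0r //; apply/rowP => a; rewrite !mxE.
  apply: (le_trans (ler_norm_sum _ _ _)).
  apply: (le_trans (ler_sum _ (fun a _ => step a))).
  rewrite sumr_const card_ord -[leLHS]mulr_natl.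
  have -> : n%:R * (`|h| * (eps / n.+1%:R)) =
    eps * `|h| * (n%:R / n.+1%:R) :> R by ring.
  rewrite ler_piMr //; first by rewrite mulr_ge0 // ltW.
  by rewrite ler_pdivrMr // mul1r ler_nat.
Unshelve. all: by end_near. Qed.

(** * Positive definite matrices *)

Section InnerAlgebra.
Context {R : realType} {n : nat}.
Implicit Types (A : 'M[R]_n) (u v w : 'rV[R]_n).

Lemma inner_linl A w a u v :
  inner A (a *: u + v) w = a * inner A u w + inner A v w.
Proof. by rewrite /inner !mulmxDl -!scalemxAl !mxE. Qed.

Lemma inner_linr A w a u v :
  inner A w (a *: u + v) = a * inner A w u + inner A w v.
Proof. by rewrite /inner linearP /= mulmxDr -scalemxAr !mxE. Qed.

Lemma inner_Dl A w u v : inner A (u + v) w = inner A u w + inner A v w.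
Proof. by rewrite /inner !mulmxDl !mxE. Qed.

Lemma inner_Dr A w u v : inner A w (u + v) = inner A w u + inner A w v.
Proof. by rewrite /inner linearD /= mulmxDr !mxE. Qed.

Lemma inner_Zl A w a u : inner A (a *: u) w = a * inner A u w.
Proof. by rewrite /inner -!scalemxAl !mxE. Qed.

Lemma inner_Zr A w a u : inner A w (a *: u) = a * inner A w u.
Proof. by rewrite /inner linearZ /= -scalemxAr !mxE. Qed.

Lemma inner_0l A w : inner A 0 w = 0.
Proof. by rewrite /inner !mul0mx mxE. Qed.

Lemma inner_0r A w : inner A w 0 = 0.
Proof. by rewrite /inner trmx0 mulmx0 mxE. Qed.

Lemma inner_0mx u v : inner 0 u v = 0.
Proof. by rewrite /inner mulmx0 mul0mx mxE. Qed.

Lemma inner_Bmx A B u v : inner (A - B) u v = inner A u v - inner B u v.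
Proof. by rewrite /inner mulmxBr mulmxBl !mxE. Qed.

Lemma inner_sym A u v : A^T = A -> inner A u v = inner A v u.
Proof.
move=> sA; rewrite /inner -[in LHS](trmxK (u *m A *m v^T)) [in LHS]mxE.
by rewrite !trmx_mul trmxK sA mulmxA.
Qed.

Lemma inner_scalemx A u v : (u *m A *m v^T) = (inner A u v)%:M.
Proof. exact: mx11_scalar. Qed.

Definition posdef A := forall v, v != 0 -> 0 < inner A v v.

Lemma posdef_ge0 A v : posdef A -> 0 <= inner A v v.
Proof.
by have [->|v0] := eqVneq v 0; [rewrite inner_0l|move=> /(_ v v0)/ltW].
Qed.

(** The component of [u] orthogonal to [v] is orthogonal to itself. *)
Lemma posdef_colinear A u v : posdef A -> A^T = A -> 0 < inner A v v ->
  (forall w, inner A v w = 0 -> inner A u w = 0) ->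
  u = (inner A u v / inner A v v) *: v.
Proof.
move=> pA sA v0 uv; set c := _ / _; apply/eqP; rewrite -subr_eq0.
apply: contraT => /pA.
have vw : inner A v (u - c *: v) = 0.
  rewrite -scaleNr inner_Dr inner_Zr /c (inner_sym v u sA) mulNr divfK.
    by rewrite subrr.
  by rewrite gt_eqF.
by rewrite {1}addrC -scaleNr inner_linl scaleNr vw mulr0 add0r uv // ltxx.
Qed.

(** The vectors orthogonal to [v] are the kernel of a matrix with a single
    column, whose rank is at most 1 < n; the dimension 0 has no nonzero [v]. *)
Lemma exists_unit_orthogonal A v : n <> 1%N -> posdef A -> v != 0 ->
  exists2 u, inner A u u = 1 & inner A u v = 0.
Proof.
move=> n1 pA v0; pose c := A *m v^T.
have n2 : (1 < n)%N.
  case: n n1 v v0 {c pA A} => [|[|m]] // _ v; case/negP; apply/eqP/rowP.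
  by case.
have : kermx c != 0.
  apply: contraTneq n2 => k0; rewrite -leqNgt.
  have := mxrank_ker c; rewrite k0 mxrank0 => /esym/eqP; rewrite subn_eq0.
  by move=> /leq_trans; apply; exact: rank_leq_col.
move=> /rowV0Pn[w wk w0]; have W0 := pA _ w0.
have wv : inner A w v = 0.
  rewrite /inner -mulmxA.
  by move/sub_kermxP: wk => ->; rewrite mxE.
exists ((Num.sqrt (inner A w w))^-1 *: w); last by rewrite inner_Zl wv mulr0.
rewrite inner_Zl inner_Zr mulrA -invfM -expr2 sqr_sqrtr ?ltW //.
by rewrite mulVf // gt_eqF.
Qed.

End InnerAlgebra.

(** * The cubic tensor of a chart and the tangent vectors of a sphere bundle *)

Section Chart.
Context {R : realType} {n : nat} {U : set 'rV[R]_n} {g : 'rV[R]_n -> 'M[R]_n}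
  {D : 'rV[R]_n -> 'rV[R]_n -> 'rV[R]_n -> 'rV[R]_n}.
Context (oU : open U) (g_smooth : smooth_on U g)
  (g_sym : forall x, U x -> (g x)^T = g x)
  (D_linr : forall x a u v v', U x ->
     D x u (a *: v + v') = a *: D x u v + D x u v')
  (C_sym12 : forall x u v w, U x ->
     cov_metric D g x u v w = cov_metric D g x v u w).

Lemma metric_derivable x u : U x -> derivable g x u.
Proof. by move=> Ux; have [_ /(_ u) [dg _]] := g_smooth 1; exact: dg. Qed.

Lemma is_derive_metric x u v w : U x ->
  is_derive x u (fun x' => inner (g x') v w : R^o) (inner ('D_u g x) v w).
Proof.
move=> Ux.
have := is_derive_inner (derivableP (@metric_derivable x u Ux))
  (is_derive_cst v x u) (is_derive_cst w x u).
by move=> H; apply: (is_derive_eq H); rewrite inner_0l inner_0r !addr0.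
Qed.

Lemma cov_metricE x u v w : U x -> cov_metric D g x u v w =
  inner ('D_u g x) v w - inner (g x) (D x u v) w - inner (g x) v (D x u w).
Proof.
by move=> Ux; rewrite /cov_metric; have [_ ->] := is_derive_metric u v w Ux.
Qed.

Lemma cov_metric_sym23 x u v w : U x ->
  cov_metric D g x u v w = cov_metric D g x u w v.
Proof.
move=> Ux; rewrite /cov_metric (inner_sym _ w (g_sym Ux)).
rewrite [inner _ v _](inner_sym _ _ (g_sym Ux)) addrAC; congr (_ - _ - _).
apply: near_eq_derive.
by apply: filterS (open_nbhs_nbhs (conj oU Ux)) => y Uy; exact/inner_sym/g_sym.
Qed.

Lemma cov_metric_lin2 x u a v v' w : U x -> cov_metric D g x u (a *: v + v') w =
  a * cov_metric D g x u v w + cov_metric D g x u v' w.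
Proof.
by move=> Ux; rewrite !cov_metricE // D_linr // !inner_linl; ring.
Qed.

(** Additivity in the direction of differentiation is inherited from the other
    slots by the symmetry of the cubic tensor. *)
Lemma cov_metric_lin1 x a u u' v w : U x -> cov_metric D g x (a *: u + u') v w =
  a * cov_metric D g x u v w + cov_metric D g x u' v w.
Proof. by move=> Ux; rewrite !(C_sym12 _ v) // cov_metric_lin2. Qed.

Lemma cov_metric_lin3 x u a v w w' : U x -> cov_metric D g x u v (a *: w + w') =
  a * cov_metric D g x u v w + cov_metric D g x u v w'.
Proof. by move=> Ux; rewrite !(cov_metric_sym23 _ v) // cov_metric_lin2. Qed.

(** Every vector in the kernel of the differential of |y|^2 is tangent to the
    sphere bundle: move along the straight line of direction (X, V) and rescale
    the fibre component to the length r.  By hypothesis the length is stationary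
    at t = 0, so that rescaling does not change the velocity. *)
Lemma tangent_sphere (r : R) x y X V : 0 < r -> U x ->
  inner (g x) y y = r ^+ 2 ->
  inner ('D_X g x) y y + 2 * inner (g x) V y = 0 ->
  tangent_space [set z | U (lsubmx z) /\
      inner (g (lsubmx z)) (rsubmx z) (rsubmx z) = r ^+ 2]
    (row_mx x y) (row_mx X V).
Proof.
move=> r0 Ux yr df.
pose p (t : R^o) := t *: X + x; pose q (t : R^o) := t *: V + y.
pose s (t : R^o) : R^o := inner (g (p t)) (q t) (q t).
pose c (t : R^o) := row_mx (p t) ((r * (Num.sqrt (s t))^-1) *: q t).
have p0 : p 0 = x by rewrite /p scale0r add0r.
have q0 : q 0 = y by rewrite /q scale0r add0r.
have s0 : s 0 = r ^+ 2 by rewrite /s p0 q0.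
pose E := [set t : R^o | U (p t)].
have oE : open E.
  apply: (@open_comp _ _ p) oU => t _; exact: continuous_line.
have Cs k : Ck_on k E s.
  apply: Ck_on_inner => //; try exact: Ck_on_line.
  by apply: Ck_on_comp_line; exact: g_smooth.
have : \forall t \near (0 : R^o), E t /\ 0 < s t.
  have E0 : E 0 by rewrite /E /= p0.
  near=> t; split; first by near: t; exact: open_nbhs_nbhs.
  near: t; have [cs _] := Cs 0%N.
  have cs0 : s t @[t --> (0 : R^o)] --> s 0 := cs _ E0.
  by apply: (cvgr_gt (s 0) cs0); rewrite s0 exprn_gt0.
move=> /nbhs_ballP[eps /= eps0 Eeps].
have oB : open (ball (0 : R^o) eps) by exact: ball_open.
have dc : is_derive (0 : R^o) (1 : R^o) c (row_mx X V).
  have ds : is_derive (0 : R^o) (1 : R^o) s 0.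
    have dg : is_derive (0 : R^o) (1 : R^o) (g \o p) ('D_X g x).
      apply/(is_derive_along_line g x X)/derivableP; exact: metric_derivable.
    have dq := is_derive_line V y (0 : R^o).
    have := is_derive_inner dg dq dq; move=> H; apply: (is_derive_eq H).
    rewrite -/(q 0) /= p0 q0 (inner_sym y V (g_sym Ux)) -df; ring.
  have di := is_derive_invsqrt_comp _ ds.
  have s00 : 0 < s 0 by rewrite s0 exprn_gt0.
  have dphi : is_derive (0 : R^o) (1 : R^o)
      (fun t : R^o => r * (Num.sqrt (s t))^-1 : R^o) 0.
    rewrite (_ : (fun t : R^o => _) =
       r *: (fun t : R^o => (Num.sqrt (s t))^-1 : R^o)) //.
    have := is_deriveZ r (di s00); move=> H; apply: (is_derive_eq H).
    by rewrite mulr0 mul0r scaler0.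
  have := is_derive_row_mx (is_derive_line X x (0 : R^o))
    (is_derive_scalemx dphi (is_derive_line V y (0 : R^o))).
  move=> H; apply: (is_derive_eq H).
  rewrite scale0r add0r s0 sqrtr_sqr gtr0_norm // mulfV ?scale1r //.
  by rewrite gt_eqF.
exists eps, c; split=> //.
- move=> k; apply: Ck_on_row_mx => //; first exact: Ck_on_line.
  apply: Ck_on_scalemx => //; last exact: Ck_on_line.
  apply: Ck_onM => //; first exact: Ck_on_cst.
  apply: Ck_on_invsqrt => // [t /Eeps[] //|].
  by apply: Ck_on_subset (Cs k) => t /Eeps[].
- rewrite /c p0 q0 s0 sqrtr_sqr gtr0_norm // mulfV ?scale1r //.
  by rewrite gt_eqF.
- move=> t /Eeps[Et st]; rewrite /= /c row_mxKl row_mxKr; split=> //.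
  rewrite inner_Zl inner_Zr -/(s t) mulrA -expr2 exprMn -mulrA.
  rewrite exprVn sqr_sqrtr ?ltW // mulVf ?mulr1 // gt_eqF //.
- by rewrite derive1E; case: dc.
Unshelve. all: by end_near. Qed.

End Chart.

(** * Bilinear forms in an orthonormal basis *)

Section Frames.
Context {R : realType} {m : nat}.
Implicit Types (A : 'M[R]_m) (T : set 'rV[R]_m).

Definition linear_subspace T :=
  T 0 /\ forall a u v, T u -> T v -> T (a *: u + v).

Lemma linear_subspace_sum T k (a : 'I_k -> R) (e : 'I_k -> 'rV[R]_m)
    (s : seq 'I_k) :
  linear_subspace T -> (forall i, T (e i)) -> T (\sum_(i <- s) a i *: e i).
Proof.
move=> [T0 Tl] Te; elim: s => [|i s IH]; first by rewrite big_nil.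
by rewrite big_cons; exact: Tl.
Qed.

Lemma linear_on_sum T (f : 'rV[R]_m -> R) k (a : 'I_k -> R)
    (e : 'I_k -> 'rV[R]_m) :
  linear_subspace T ->
  (forall a u u', T u -> T u' -> f (a *: u + u') = a * f u + f u') ->
  (forall i, T (e i)) -> f (\sum_i a i *: e i) = \sum_i a i * f (e i).
Proof.
move=> sT fl Te; have [T0 _] := sT.
have f0 : f 0 = 0.
  have := fl 1 0 0 T0 T0; rewrite scaler0 addr0 mul1r => /eqP.
  by rewrite -subr_eq subrr eq_sym => /eqP.
elim: (index_enum _) => [|i s IH]; first by rewrite !big_nil.
by rewrite !big_cons fl ?IH //; exact: linear_subspace_sum.
Qed.

(** For v = sum of a_i e_i the numbers a_i a_j form a unit vector, and h(v, v)
    is its scalar product with the matrix of h: this is the Cauchy-Schwarz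
    inequality. *)
Lemma sqr_form_le_tensor A T k (e : 'I_k -> 'rV[R]_m) h v :
  linear_subspace T -> orthonormal_basis A T e ->
  (forall a u u' w, T u -> T u' -> T w ->
     h (a *: u + u') w = a * h u w + h u' w) ->
  (forall a u w w', T u -> T w -> T w' ->
     h u (a *: w + w') = a * h u w + h u w') ->
  T v -> inner A v v = 1 -> h v v ^+ 2 <= \sum_i \sum_j h (e i) (e j) ^+ 2.
Proof.
move=> sT [Te eo espan] hl hr Tv v1; have [a va] := espan v Tv.
have bil (f : 'rV[R]_m -> 'rV[R]_m -> R) :
    (forall a u u' w, T u -> T u' -> T w ->
       f (a *: u + u') w = a * f u w + f u' w) ->
    (forall a u w w', T u -> T w -> T w' ->
       f u (a *: w + w') = a * f u w + f u w') ->
    f v v = \sum_i \sum_j (a i * a j) * f (e i) (e j).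
  move=> fl fr; rewrite {1}va (linear_on_sum (T := T) (f := fun u => f u v)) //;
    last by move=> b u u' Tu Tu'; exact: fl.
  apply: eq_bigr => i _; rewrite va (linear_on_sum (T := T)) //;
    last by move=> b u u' Tu Tu'; exact: fr.
  by rewrite mulr_sumr; apply: eq_bigr => j _; rewrite mulrA.
have a1 : \sum_i a i ^+ 2 = 1.
  rewrite -v1 (bil (inner A)); last 2 first.
  - by move=> *; exact: inner_linl.
  - by move=> *; exact: inner_linr.
  apply: eq_bigr => i _; rewrite (bigD1 i) //= eo eqxx mulr1 -expr2.
  rewrite big1 ?addr0 // => j ji; rewrite eo eq_sym (negbTE ji) mulr0 //.
set t := h v v.
have tE : t = \sum_i \sum_j (a i * a j) * h (e i) (e j) := bil _ hl hr.
have aa1 : \sum_i \sum_j (a i * a j) ^+ 2 = 1.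
  rewrite -[RHS]mulr1 -{1}a1 mulr_suml; apply: eq_bigr => i _.
  by rewrite -a1 mulr_sumr; apply: eq_bigr => j _; rewrite exprMn.
(* Cauchy-Schwarz: expand the squared distance from the matrix of h to its
   projection on the unit vector (a_i a_j). *)
have : 0 <= \sum_i \sum_j (h (e i) (e j) - t * (a i * a j)) ^+ 2.
  by apply: sumr_ge0 => i _; apply: sumr_ge0 => j _; exact: sqr_ge0.
have -> : \sum_i \sum_j (h (e i) (e j) - t * (a i * a j)) ^+ 2 =
  \sum_i \sum_j h (e i) (e j) ^+ 2 +
  - (2 * t) * (\sum_i \sum_j (a i * a j) * h (e i) (e j)) +
  t ^+ 2 * \sum_i \sum_j (a i * a j) ^+ 2.
  rewrite !mulr_sumr -!big_split /=; apply: eq_bigr => i _.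
  rewrite !mulr_sumr -!big_split /=; apply: eq_bigr => j _; ring.
by rewrite -tE aa1 => H; lra.
Qed.

End Frames.

(** * The second fundamental form at a point of the sphere bundle *)

(** With q = g(Z, Z) and m = lambda^2 r^2, this says that the normal cannot be
    nearly horizontal. *)
Lemma quarter_bound (R : realFieldType) (q m : R) : 0 <= q -> q + m = 1 ->
  4 * q ^+ 2 <= m * q -> 2^-1 ^+ 2 <= m.
Proof.
move=> q0 qm le4; rewrite leNgt; apply/negP => m4.
have q34 : 3 / 4 < q by move: m4; rewrite expr2; lra.
have : 0 < q * (4 * q - m) by rewrite mulr_gt0 //; lra.
by move: le4; rewrite expr2 mulrBr => H; lra.
Qed.

(** In what follows [g], [D], [G] and [DG] are the components in one chart of
    the metric, the connection, the Sasakian metric and its Levi-Civita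
    connection; [GE] is the Sasakian metric in the natural coordinates. *)
Section SphereBundle.
Context {R : realType} {n : nat} {U : set 'rV[R]_n} {g : 'rV[R]_n -> 'M[R]_n}
  {D : 'rV[R]_n -> 'rV[R]_n -> 'rV[R]_n -> 'rV[R]_n}
  {G : 'rV[R]_(n + n) -> 'M[R]_(n + n)}
  {DG : 'rV[R]_(n + n) -> 'rV[R]_(n + n) -> 'rV[R]_(n + n) -> 'rV[R]_(n + n)}.
Context (oU : open U) (g_smooth : smooth_on U g)
  (g_sym : forall x, U x -> (g x)^T = g x)
  (g_pos : forall x, U x -> posdef (g x))
  (D_linl : forall x a u u' v, U x ->
     D x (a *: u + u') v = a *: D x u v + D x u' v)
  (D_linr : forall x a u v v', U x ->
     D x u (a *: v + v') = a *: D x u v + D x u v')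
  (C_sym12 : forall x u v w, U x ->
     cov_metric D g x u v w = cov_metric D g x v u w)
  (GE : forall x y X V X' V', U x ->
     inner (G (row_mx x y)) (row_mx X V) (row_mx X' V') =
     inner (g x) X X' + inner (g x) (V + D x X y) (V' + D x X' y))
  (G_sym : forall z, U (lsubmx z) -> (G z)^T = G z)
  (DG_metric : forall z u v w, U (lsubmx z) -> cov_metric DG G z u v w = 0)
  (DG_sym : forall z u v, U (lsubmx z) -> DG z u v = DG z v u).

Lemma D_0l x v : U x -> D x 0 v = 0.
Proof.
move=> Ux; have := D_linl 1 0 0 v Ux; rewrite scaler0 addr0 scale1r => /eqP.
by rewrite -subr_eq subrr eq_sym => /eqP.
Qed.

Lemma GE_vertl x y u X V : U x ->
  inner (G (row_mx x y)) (row_mx 0 u) (row_mx X V) =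
  inner (g x) u (V + D x X y).
Proof. by move=> Ux; rewrite GE // D_0l // inner_0l add0r addr0. Qed.

(** Along a fibre, the pairing of a vertical vector with (X, V) is an affine
    function of y. *)
Lemma derive_metric_vertical x y u X V : U x ->
  is_derive (row_mx x y) (row_mx 0 u)
    (fun z => inner (G z) (row_mx 0 u) (row_mx X V) : R^o)
    (inner (g x) u (D x X u)).
Proof.
move=> Ux; apply/is_derive_along_line.
have e : (fun t : R^o => inner (G (t *: row_mx 0 u + row_mx x y))
      (row_mx 0 u) (row_mx X V) : R^o) =
    (fun t : R^o => t *: (inner (g x) u (D x X u) : R^o) +
                    inner (g x) u (V + D x X y)).
  apply/funext => t; rewrite scale_row_mx add_row_mx scaler0 add0r GE_vertl //.
  by rewrite D_linr // addrCA inner_linr.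
by rewrite e; exact: is_derive_line.
Qed.

(** The square length of a constant vertical vector does not depend on y. *)
Lemma derive_metric_vertical_norm x y u X V : U x ->
  is_derive (row_mx x y) (row_mx X V)
    (fun z => inner (G z) (row_mx 0 u) (row_mx 0 u) : R^o)
    (inner ('D_X g x) u u).
Proof.
move=> Ux.
have H : is_derive (row_mx x y) (row_mx X V)
    (fun z => inner (g (lsubmx z)) u u : R^o) (inner ('D_X g x) u u).
  apply/is_derive_along_line.
  rewrite (_ : (fun t : R^o => _) =
      fun t : R^o => inner (g (t *: X + x)) u u : R^o).
    by apply/(is_derive_along_line (fun x' => inner (g x') u u : R^o));
       exact: is_derive_metric.
  by apply/funext => t; rewrite scale_row_mx add_row_mx row_mxKl.
apply: near_eq_is_derive H.
have nU : \forall z \near row_mx x y, U (lsubmx z).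
  have cl : {for row_mx x y, continuous (@lsubmx R 1 n n)}.
    exact: continuous_lsubmx.
  apply: cl; apply: open_nbhs_nbhs; split=> //; by rewrite row_mxKl.
apply: filterS nU => z Uz.
by rewrite -{2}[z]hsubmxK GE_vertl // D_0l // addr0.
Qed.

(** The Koszul formula for coordinate fields, whose brackets vanish: the value
    is the derivative of <u0, w> along u0 minus half the derivative of
    <u0, u0> along w. *)
Lemma koszul_vertical x y u X V : U x ->
  let U0 := row_mx 0 u in
  2 * inner (G (row_mx x y)) (DG (row_mx x y) U0 U0) (row_mx X V) =
  - cov_metric D g x X u u.
Proof.
move=> Ux /=; set z := row_mx x y; set u0 := row_mx 0 u; set w := row_mx X V.
have Uz : U (lsubmx z) by rewrite row_mxKl.
have := DG_metric u0 u0 w Uz; have := DG_metric w u0 u0 Uz.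
rewrite /cov_metric.
have [_ ->] := derive_metric_vertical_norm y u X V Ux.
have [_ ->] := derive_metric_vertical y u X V Ux.
rewrite (inner_sym u0 _ (G_sym Uz)) (DG_sym w u0 Uz).
rewrite (inner_sym u0 (DG z u0 w) (G_sym Uz)).
have [_ ->] := is_derive_metric g_smooth X u u Ux.
rewrite (inner_sym _ u (g_sym Ux)) => E1 E2; lra.
Qed.

Section AtPoint.
Context (x y : 'rV[R]_n) (r : R) (N : 'rV[R]_(n + n)).
Let S := [set z : 'rV[R]_(n + n) | U (lsubmx z) /\
      inner (g (lsubmx z)) (rsubmx z) (rsubmx z) = r ^+ 2].
Let z := row_mx x y.
Context (Ux : U x) (r0 : 0 < r) (yr : inner (g x) y y = r ^+ 2)
  (uN : unit_normal G S z N).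
Let Z := lsubmx N.
Let W := rsubmx N + D x Z y.
(** The coefficient of y in the vertical part of the normal. *)
Definition normal_coef := inner (g x) W y / r ^+ 2.
Local Notation lambda := normal_coef.

Lemma normal_inner X V : inner (G z) N (row_mx X V) =
  inner (g x) Z X + inner (g x) W (V + D x X y).
Proof. by rewrite -[N]hsubmxK GE // row_mxKl row_mxKr. Qed.

Lemma normal_orth X V :
  inner ('D_X g x) y y + 2 * inner (g x) V y = 0 ->
  inner (g x) Z X + inner (g x) W (V + D x X y) = 0.
Proof.
move=> /(tangent_sphere oU g_smooth g_sym r0 Ux yr) TV.
by rewrite -normal_inner; case: uN => _; apply.
Qed.

(** The vertical vectors (0, b) with b orthogonal to y are tangent, hence
    orthogonal to N. *)
Lemma normal_vertical_part : W = lambda *: y.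
Proof.
rewrite /lambda -yr; apply: posdef_colinear; [exact: g_pos|exact: g_sym| |].
  by rewrite yr exprn_gt0.
move=> b yb; have := @normal_orth 0 b; rewrite derive0 inner_0mx.
rewrite (inner_sym b y (g_sym Ux)) yb mulr0 addr0 => /(_ erefl).
by rewrite D_0l // inner_0r add0r addr0.
Qed.

(** The vector (X, V) is tangent for the multiple V of y that compensates the
    variation of |y|^2 along X; its scalar product with N vanishes. *)
Lemma normal_horizontal_part X :
  2 * inner (g x) Z X = lambda * cov_metric D g x X y y.
Proof.
have rn : r != 0 by rewrite gt_eqF.
have := @normal_orth X (- (inner ('D_X g x) y y / (2 * r ^+ 2)) *: y).
rewrite inner_Zl yr normal_vertical_part.
rewrite inner_Zl inner_Dr inner_Zr yr (cov_metricE g_smooth) //.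
rewrite (inner_sym _ y (g_sym Ux)) => H.
have {}H := H _; set d := inner ('D_X g x) y y in H *.
have e : - (d / (2 * r ^+ 2)) * r ^+ 2 = - d / 2 by field.
rewrite e in H; have {}H : _ := H ltac:(lra); lra.
Qed.

Lemma normal_norm : inner (g x) Z Z + lambda ^+ 2 * r ^+ 2 = 1.
Proof.
have := normal_inner Z (rsubmx N); rewrite hsubmxK -/W; case: uN => -> _ ->.
by rewrite normal_vertical_part inner_Zl inner_Zr yr expr2 mulrA.
Qed.

Lemma normal_coef_neq0 : lambda != 0.
Proof.
apply/eqP => l0; have := normal_norm; have := normal_horizontal_part Z.
rewrite l0 => E1 E2; lra.
Qed.

(** N is proportional to the gradient of |y|^2.  This identifies the tangent
    space, defined by velocities of curves, with a hyperplane. *)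
Lemma normal_df X V : 2 * inner (G z) N (row_mx X V) =
  lambda * (inner ('D_X g x) y y + 2 * inner (g x) V y).
Proof.
rewrite normal_inner mulrDr normal_horizontal_part (cov_metricE g_smooth) //.
rewrite normal_vertical_part inner_Zl inner_Dr.
rewrite (inner_sym _ y (g_sym Ux)) (inner_sym V y (g_sym Ux)); ring.
Qed.

Lemma tangent_spaceP v : tangent_space S z v <-> inner (G z) N v = 0.
Proof.
split; first by case: uN => _; apply.
rewrite -[v]hsubmxK => v0; apply: (tangent_sphere oU g_smooth g_sym) => //.
have := normal_df (lsubmx v) (rsubmx v); rewrite v0 mulr0 => /esym/eqP.
by rewrite mulf_eq0 (negbTE normal_coef_neq0) => /eqP.
Qed.

Lemma tangent_linear : linear_subspace (tangent_space S z).
Proof.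
split=> [|a u v]; first by apply/tangent_spaceP; rewrite inner_0r.
move=> /tangent_spaceP Nu /tangent_spaceP Nv; apply/tangent_spaceP.
by rewrite inner_linr Nu Nv mulr0 addr0.
Qed.

(** The field w |-> (0, (g(w, y) u - g(w, u) y) / r^2), w being the fibre
    variable, is the infinitesimal rotation of each fibre in the plane of y
    and u: it is tangent to the spheres, equals u^v at (x, y), and its
    derivative along u^v is the vertical lift of - y / r^2. *)
Lemma second_fundamental_form_vertical h u :
  second_fundamental_form G DG S z N h ->
  inner (g x) u u = 1 -> inner (g x) u y = 0 ->
  tangent_space S z (row_mx 0 u) /\
  h (row_mx 0 u) (row_mx 0 u) = - lambda - 2^-1 * cov_metric D g x Z u u.
Proof.
move=> [_ _ hB] u1 uy; have rn : r != 0 by rewrite gt_eqF.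
have Tvert x' y' b : S (row_mx x' y') -> inner (g x') b y' = 0 ->
    tangent_space S (row_mx x' y') (row_mx 0 b).
  move=> [/=]; rewrite row_mxKl row_mxKr => Ux' yr' by0.
  apply: (tangent_sphere oU g_smooth g_sym) => //.
  by rewrite derive0 inner_0mx by0 mulr0 addr0.
have Sz : S z by split=> /=; rewrite row_mxKl ?row_mxKr.
have Tu := Tvert x y u Sz uy; split=> //.
(* The rotation field is w g(x) K, which is visibly smooth. *)
pose K : 'M[R]_(n, n + n) :=
  r ^- 2 *: (y^T *m row_mx 0 u - u^T *m row_mx 0 y).
pose B (w : 'rV[R]_(n + n)) := rsubmx w *m g (lsubmx w) *m K.
have BE x' y' : B (row_mx x' y') =
    row_mx 0 (r ^- 2 *: (inner (g x') y' y *: u - inner (g x') y' u *: y)).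
  rewrite /B /K row_mxKl row_mxKr -scalemxAr mulmxBr !mulmxA !inner_scalemx.
  rewrite !mul_scalar_mx !scale_row_mx opp_row_mx add_row_mx scale_row_mx.
  by rewrite !scaler0 subr0 scaler0.
pose O := [set w : 'rV[R]_(n + n) | U (lsubmx w)].
have oO : open O.
  apply: (@open_comp _ _ (@lsubmx R 1 n n)) oU => w _.
  exact: continuous_lsubmx.
have sB : smooth_on O B.
  move=> k; apply: Ck_on_mulmx => //; last exact: Ck_on_cst.
  apply: Ck_on_mulmx => //.
    apply: (@Ck_on_subset _ _ _ k O ((@rsubmx R 1 n n) @^-1` setT)) => //.
    apply: (@Ck_on_comp_affine _ _ _ _ k setT id
      (@rsubmx R 1 n n) (@rsubmx R 1 n n)).
    - exact: continuous_rsubmx.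
    - by move=> w v t; rewrite linearP.
    - exact: Ck_on_id.
  apply: (@Ck_on_comp_affine _ _ _ _ k U g (@lsubmx R 1 n n) (@lsubmx R 1 n n)).
  - exact: continuous_lsubmx.
  - by move=> w v t; rewrite linearP.
  - exact: g_smooth.
have tB w : O w -> S w -> tangent_space S w (B w).
  rewrite -[w]hsubmxK /O /= row_mxKl => Uw Sw; rewrite BE; apply: Tvert => //.
  rewrite -scaleNr inner_Zl inner_Dl !inner_Zl.
  rewrite (inner_sym u _ (g_sym Uw)) (inner_sym y _ (g_sym Uw)); ring.
have Bz : B z = row_mx 0 u.
  rewrite BE yr (inner_sym y u (g_sym Ux)) uy scale0r subr0 scalerA.
  by rewrite mulVf ?scale1r // expf_neq0.
have Oz : O z by rewrite /O /= row_mxKl.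
have := hB O B (row_mx 0 u) oO Oz sB tB Tu; rewrite Bz => ->.
have dB : is_derive z (row_mx 0 u) B (row_mx 0 (- (r ^- 2) *: y)).
  apply/is_derive_along_line.
  rewrite (_ : (fun t : R^o => _) = fun t : R^o =>
     t *: row_mx 0 (- (r ^- 2) *: y) + row_mx 0 u); first exact: is_derive_line.
  apply/funext => t; rewrite /z scale_row_mx add_row_mx scaler0 add0r BE.
  rewrite !inner_linl yr uy u1 (inner_sym y u (g_sym Ux)) uy.
  rewrite scale_row_mx add_row_mx scaler0 addr0 mulr0 add0r addr0 mulr1.
  rewrite scalerBr !scalerA mulVf ?expf_neq0 // scale1r addrC -scaleNr.
  by rewrite mulrN mulrC.
rewrite /cov; case: dB => _ ->; rewrite Bz inner_Dl.
rewrite -{1}[N]hsubmxK GE_vertl // -/Z -/W normal_vertical_part.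
rewrite inner_Zl inner_Zr yr.
have := koszul_vertical y u Z (rsubmx N) Ux; rewrite /= hsubmxK => E.
have -> : - r ^- 2 * (lambda * r ^+ 2) = - lambda by field.
set q := inner _ _ _ in E *; lra.
Qed.

Lemma tensor_norm_lower_bound (hn : n <> 1%N) h k (e : 'I_k -> 'rV[R]_(n + n))
    (K L : R) :
  second_fundamental_form G DG S z N h ->
  orthonormal_basis (G z) (tangent_space S z) e ->
  (forall X v, cov_metric D g x X v v ^+ 2 <=
     K * inner (g x) X X * inner (g x) v v ^+ 2) ->
  1 <= K -> K * r ^+ 2 <= 1 -> L + K < (2 * r)^-1 -> L < tensor_norm e h.
Proof.
move=> hh he CK K1 Kr Lr.
have y0 : y != 0.
  by apply: contraTneq r0 => y0; move: yr; rewrite y0 inner_0l => /esym/eqP;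
     rewrite expf_eq0 /= => /eqP ->; rewrite ltxx.
have [u u1 uy] := exists_unit_orthogonal hn (g_pos Ux) y0.
have [Tu hu] := second_fundamental_form_vertical hh u1 uy.
have uu1 : inner (G z) (row_mx 0 u) (row_mx 0 u) = 1.
  by rewrite GE_vertl // D_0l // addr0.
have [hl hr _] := hh.
have := sqr_form_le_tensor tangent_linear he hl hr Tu uu1.
rewrite /tensor_norm => hS.
apply: lt_le_trans (ler_wsqrtr hS); rewrite sqrtr_sqr hu.
set q := inner (g x) Z Z.
have q0 : 0 <= q by exact: posdef_ge0 (g_pos Ux).
have nq := normal_norm; rewrite -/q in nq.
have q1 : q <= 1.
  by rewrite -nq lerDl mulr_ge0 ?sqr_ge0.
have C1 : `|cov_metric D g x Z u u| <= K.
  rewrite -(@ler_pXn2r _ 2) ?nnegrE //; last lra.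
  rewrite real_normK ?num_real //; apply: le_trans (CK Z u) _.
  rewrite u1 expr1n mulr1 -/q (@le_trans _ _ K) //.
    by rewrite ler_piMr //; lra.
  by rewrite expr2 ler_peMr //; lra.
have C2 := CK Z y; have hZ := normal_horizontal_part Z.
rewrite -/q in hZ C2; rewrite yr in C2.
(* Z is controlled by lambda: 4 q^2 = lambda^2 C(Z, y, y)^2, and the bound on C
   makes this at most lambda^2 r^2 q. *)
have l2 : 2^-1 ^+ 2 <= lambda ^+ 2 * r ^+ 2.
  set c := cov_metric D g x Z y y in hZ C2.
  have m0 : 0 <= lambda ^+ 2 * r ^+ 2 by rewrite mulr_ge0 ?sqr_ge0.
  have qq : 4 * q ^+ 2 <= lambda ^+ 2 * r ^+ 2 * q.
    have -> : 4 * q ^+ 2 = lambda ^+ 2 * c ^+ 2 by rewrite -exprMn -hZ; ring.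
    apply: (@le_trans _ _ (lambda ^+ 2 * (K * q * r ^+ 2 ^+ 2))).
      by rewrite ler_wpM2l ?sqr_ge0.
    have -> : lambda ^+ 2 * (K * q * r ^+ 2 ^+ 2) =
      lambda ^+ 2 * r ^+ 2 * q * (K * r ^+ 2) by ring.
    by rewrite ler_piMr // mulr_ge0.
  exact: quarter_bound q0 nq qq.
have : `|lambda| >= (2 * r)^-1.
  rewrite -(@ler_pXn2r _ 2) ?nnegrE ?normr_ge0 ?invr_ge0 ?mulr_ge0 ?(ltW r0) //.
  rewrite real_normK ?num_real // invfM exprMn (exprVn r).
  by rewrite ler_pdivrMr // exprn_gt0.
move=> ll.
have : `|lambda| <= `|- lambda - 2^-1 * cov_metric D g x Z u u| + 2^-1 * K.
  have := ler_normD (- lambda - 2^-1 * cov_metric D g x Z u u)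
    (2^-1 * cov_metric D g x Z u u).
  rewrite subrK normrN (normrM 2^-1) ger0_norm ?invr_ge0 // => /le_trans.
  by apply; rewrite lerD2l ler_wpM2l ?invr_ge0.
lra.
Qed.

End AtPoint.
End SphereBundle.

(** * Local bounds on the cubic tensor *)

Section LocalBound.
Context {R : realType} {n : nat}.

Lemma linear_bound (f : 'rV[R]_n -> R) :
  (forall a u v, f (a *: u + v) = a * f u + f v) ->
  forall u, `|f u| <= (\sum_a `|f (delta_mx 0 a)|) * `|u|.
Proof.
move=> fl u; rewrite {1}[u]row_sum_delta.
have sT : linear_subspace ([set: 'rV[R]_n]) by [].
rewrite (linear_on_sum (T := setT)) //.
apply: (le_trans (ler_norm_sum _ _ _)); rewrite mulr_suml.
apply: ler_sum => a _.
by rewrite normrM mulrC ler_wpM2l // coord_le_norm.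
Qed.

Lemma bilinear_bound (f : 'rV[R]_n -> 'rV[R]_n -> R) :
  (forall w a u v, f (a *: u + v) w = a * f u w + f v w) ->
  (forall w a u v, f w (a *: u + v) = a * f w u + f w v) ->
  forall u v, `|f u v| <=
    (\sum_a \sum_b `|f (delta_mx 0 a) (delta_mx 0 b)|) * `|u| * `|v|.
Proof.
move=> fl fr u v; apply: (le_trans (linear_bound (fl v) u)).
rewrite mulrAC ler_wpM2r // mulr_suml; apply: ler_sum => a _.
exact: linear_bound.
Qed.

Lemma trilinear_bound (f : 'rV[R]_n -> 'rV[R]_n -> 'rV[R]_n -> R) :
  (forall w w' a u v, f (a *: u + v) w w' = a * f u w w' + f v w w') ->
  (forall w w' a u v, f w (a *: u + v) w' = a * f w u w' + f w v w') ->
  (forall w w' a u v, f w w' (a *: u + v) = a * f w w' u + f w w' v) ->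
  forall u v w, `|f u v w| <=
    (\sum_a \sum_b \sum_c `|f (delta_mx 0 a) (delta_mx 0 b) (delta_mx 0 c)|)
     * `|u| * `|v| * `|w|.
Proof.
move=> f1 f2 f3 u v w; apply: (le_trans (linear_bound (f1 v w) u)).
rewrite -mulrA -mulrA [`|u| * _]mulrC mulrA ler_wpM2r // mulr_suml.
apply: ler_sum => a _; rewrite mulrA; exact: bilinear_bound.
Qed.

(** The minimum over the compact unit sphere is positive, and both sides are
    homogeneous of degree 2. *)
Lemma posdef_lower_bound (A : 'M[R]_n) : posdef A ->
  exists2 c : R, 0 < c & forall v, c * `|v| ^+ 2 <= inner A v v.
Proof.
move=> pA; pose Sph := [set v : 'rV[R]_n | `|v| = 1].
have [[v0 Sv0]|noS] := pselect (Sph !=set0); last first.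
  exists 1 => // v; have [->|vn0] := eqVneq v 0.
    by rewrite normr0 expr0n mulr0 inner_0l.
  exfalso; apply: noS; exists (`|v|^-1 *: v).
  by rewrite /Sph /= normrZ normfV normr_id mulVf // normr_eq0.
have cS : compact Sph.
  apply: bounded_closed_compact.
    exists 1; split; first exact: num_real.
    by move=> M M1 v /= ->; exact: ltW.
  apply: (@preimage_closed _ _ (Num.norm : 'rV[R]_n -> R^o) [set x | x = 1]).
    by move=> v _; exact: norm_continuous.
  exact: closed_eq.
have cA : {within Sph, continuous (fun v => inner A v v : R^o)}.
  apply: continuous_subspaceT => v.
  have [H _] := Ck_on_inner openT (Ck_on_cst 0 [set: 'rV[R]_n] A)
    (@Ck_on_id R 'rV[R]_n 0 setT) (@Ck_on_id R 'rV[R]_n 0 setT).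
  exact: H.
have [v1 /[!inE] Sv1 vmin] := EVT_min_rV (ex_intro _ v0 Sv0) cS cA.
have v1n0 : v1 != 0.
  by apply: contra_eq_neq Sv1 => ->; rewrite normr0 eq_sym oner_eq0.
exists (inner A v1 v1) => [|v]; first exact: pA.
have [->|vn0] := eqVneq v 0.
  by rewrite normr0 expr0n mulr0 inner_0l.
have := vmin (`|v|^-1 *: v); rewrite inE /Sph /= normrZ normfV normr_id.
rewrite mulVf ?normr_eq0 // => /(_ erefl); rewrite inner_Zl inner_Zr mulrA.
by rewrite -invfM -expr2 mulrC ler_pdivlMr // exprn_gt0 // normr_gt0.
Qed.

(** Converts a bound in the norm of the coordinate space into one that only
    involves the metric, and is therefore independent of the chart. *)
Lemma metric_cubic_bound (A : 'M[R]_n)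
    (f : 'rV[R]_n -> 'rV[R]_n -> 'rV[R]_n -> R) (c M : R) : 0 < c -> 0 <= M ->
  (forall v, c * `|v| ^+ 2 <= inner A v v) ->
  (forall u v w, `|f u v w| <= M * `|u| * `|v| * `|w|) ->
  forall X v, f X v v ^+ 2 <= M ^+ 2 * c ^- 3 * inner A X X * inner A v v ^+ 2.
Proof.
move=> c0 M0 cA fM X v.
have nA w : `|w| ^+ 2 <= c^-1 * inner A w w by rewrite ler_pdivlMl.
rewrite -real_normK ?num_real //.
apply: (@le_trans _ _ ((M * `|X| * `|v| * `|v|) ^+ 2)).
  by rewrite ler_pXn2r ?nnegrE // !mulr_ge0.
have -> : (M * `|X| * `|v| * `|v|) ^+ 2 =
   M ^+ 2 * (`|X| ^+ 2 * (`|v| ^+ 2) ^+ 2) by ring.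
have -> : M ^+ 2 * c ^- 3 * inner A X X * inner A v v ^+ 2 =
   M ^+ 2 * ((c^-1 * inner A X X) * (c^-1 * inner A v v) ^+ 2).
  by rewrite -exprVn; ring.
rewrite ler_wpM2l ?sqr_ge0 // ler_pM ?sqr_ge0 //.
by rewrite ler_pXn2r ?nnegrE ?sqr_ge0 // (le_trans _ (nA v)) ?sqr_ge0.
Qed.

End LocalBound.

Section ChartBound.
Context {R : realType} {n : nat} {U : set 'rV[R]_n} {g : 'rV[R]_n -> 'M[R]_n}
  {D : 'rV[R]_n -> 'rV[R]_n -> 'rV[R]_n -> 'rV[R]_n}.
Context (oU : open U) (g_smooth : smooth_on U g)
  (g_sym : forall x, U x -> (g x)^T = g x)
  (g_pos : forall x, U x -> posdef (g x))
  (D_smooth : forall u v, smooth_on U (fun x => D x u v))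
  (D_linr : forall x a u v v', U x ->
     D x u (a *: v + v') = a *: D x u v + D x u v')
  (C_sym12 : forall x u v w, U x ->
     cov_metric D g x u v w = cov_metric D g x v u w).

Lemma continuous_metric x u v : U x ->
  {for x, continuous (fun x => inner (g x) u v : R^o)}.
Proof.
move=> Ux.
have [H _] :=
  Ck_on_inner oU (g_smooth 0) (Ck_on_cst 0 U u) (Ck_on_cst 0 U v).
exact: H.
Qed.

Lemma continuous_cov_metric x u v w : U x ->
  {for x, continuous (fun x => cov_metric D g x u v w : R^o)}.
Proof.
move=> Ux; rewrite /cov_metric.
have [_ /(_ u)[_ [H1 _]]] :=
  Ck_on_inner oU (g_smooth 1) (Ck_on_cst 1 U v) (Ck_on_cst 1 U w).
have [H2 _] := Ck_on_inner oU (g_smooth 0) (D_smooth u v 0) (Ck_on_cst 0 U w).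
have [H3 _] := Ck_on_inner oU (g_smooth 0) (Ck_on_cst 0 U v) (D_smooth u w 0).
exact: cvgB (cvgB (H1 _ Ux) (H2 _ Ux)) (H3 _ Ux).
Qed.

(** Near x0 the metric still dominates half of the lower bound that it has at
    x0, and the finitely many components of the cubic tensor increase by at most
    1. *)
Lemma cov_metric_locally_bounded x0 : U x0 -> exists2 K : R, 0 <= K &
  \forall x \near x0, U x /\ forall X v, cov_metric D g x X v v ^+ 2 <=
     K * inner (g x) X X * inner (g x) v v ^+ 2.
Proof.
move=> Ux0; pose e (a : 'I_n) : 'rV[R]_n := delta_mx 0 a.
have [c c0 cg] := posdef_lower_bound (g_pos Ux0).
pose M := \sum_a \sum_b \sum_d (`|cov_metric D g x0 (e a) (e b) (e d)| + 1).
pose eps := c / 2 / (n * n).+1%:R.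
have M0 : 0 <= M by do 3!(apply: sumr_ge0 => ? _); rewrite addr_ge0.
have eps0 : 0 < eps by rewrite !divr_gt0.
exists (M ^+ 2 * (c / 2) ^- 3).
  by rewrite mulr_ge0 ?sqr_ge0 // invr_ge0 exprn_ge0 // divr_ge0 // ltW.
near=> x.
have Ux : U x by near: x; exact: open_nbhs_nbhs.
split=> //; apply: metric_cubic_bound => //; first by rewrite divr_gt0.
- have gx : forall a b,
      `|inner (g x0) (e a) (e b) - inner (g x) (e a) (e b)| <= eps.
    near: x; apply: filter_forall => a; apply: filter_forall => b.
    have /cvgrPdist_le := @continuous_metric x0 (e a) (e b) Ux0; exact.
  move=> v; have b1 : `|inner (g x0 - g x) v v| <= c / 2 * `|v| ^+ 2.
    apply: (le_trans (bilinear_bound (f := inner (g x0 - g x)) _ _ v v)).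
    - by move=> *; exact: inner_linl.
    - by move=> *; exact: inner_linr.
    rewrite -mulrA -expr2 ler_wpM2r ?sqr_ge0 //.
    apply: (@le_trans _ _ (\sum_(a < n) \sum_(b < n) eps)).
      by apply: ler_sum => a _; apply: ler_sum => b _; rewrite inner_Bmx.
    rewrite !sumr_const !card_ord -mulrnA -[leLHS]mulr_natl /eps mulrCA.
    by rewrite ler_piMr ?divr_ge0 ?ltW // ltr_pdivrMr // mul1r ltr_nat.
  rewrite -[inner (g x) v v](subKr (inner (g x0) v v)) -inner_Bmx.
  have := cg v; have := ler_norm (inner (g x0 - g x) v v); lra.
- have Cx : forall a b d, `|cov_metric D g x (e a) (e b) (e d)| <=
      `|cov_metric D g x0 (e a) (e b) (e d)| + 1.
    near: x; apply: filter_forall => a; apply: filter_forall => b.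
    apply: filter_forall => d.
    have /cvgrPdist_le/(_ 1 ltr01) :=
      @continuous_cov_metric x0 (e a) (e b) (e d) Ux0.
    apply: filterS => x Hx; rewrite -lerBlDl.
    by apply: le_trans (lerB_dist _ _) _; rewrite distrC.
  move=> u v w; apply: (le_trans (trilinear_bound _ _ _ _ _ _)).
  - by move=> *; exact: (cov_metric_lin1 g_smooth D_linr C_sym12).
  - by move=> *; exact: (cov_metric_lin2 g_smooth D_linr).
  - by move=> *; exact: (cov_metric_lin3 oU g_smooth g_sym D_linr).
  rewrite !ler_wpM2r //; do 3!(apply: ler_sum => ? _); exact: Cx.
Unshelve. all: by end_near. Qed.

End ChartBound.

(** * Lifts in coordinates and change of chart *)

Section Sasaki.
Context {R : realType} {n : nat} {C : coordinates R n}.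

Lemma vliftE (x y X : 'rV[R]_n) : vlift x y X = row_mx 0 X.
Proof.
rewrite /vlift derive1E.
have -> : (fun t : R => row_mx x (y + t *: X)) =
    (fun t : R^o => row_mx x (t *: X + y)).
  by apply/funext => t; rewrite addrC.
by case: (is_derive_row_mx (is_derive_cst x (0 : R^o) 1)
  (is_derive_line X y (0 : R^o))).
Qed.

(** The velocity of the parallel transport is read off its equation at t = 0. *)
Lemma is_hliftE (D : connection_field C) i x y X W :
  is_hlift D i x y X W -> W = row_mx X (- D i x X y).
Proof.
move=> [eps [c [Y [eps0 [sc sY] [c0 c'0 Y0] geo ->]]]].
have B0 : ball (0 : R^o) eps 0 by exact: ballxx.
have dc : derivable c (0 : R^o) 1 by have [_ /(_ 1)[H _]] := sc 1%N; exact: H.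
have dY : derivable Y (0 : R^o) 1 by have [_ /(_ 1)[H _]] := sY 1%N; exact: H.
have [_ _] := geo 0 B0; rewrite /cov_along c0 c'0 Y0 => /eqP.
rewrite addr_eq0 => /eqP <-; rewrite -c'0 !derive1E.
by case: (is_derive_row_mx (derivableP dc) (derivableP dY)).
Qed.

Lemma sasakian_metricE (g : metric_field C) (D : connection_field C) hl
    (G : metric_field (tangent_coords C)) i (x y X V X' V' : 'rV[R]_n) :
  horizontal_lift D hl -> sasakian_metric g hl G -> cdom i x ->
  inner (G i (row_mx x y)) (row_mx X V) (row_mx X' V') =
  inner (g i x) X X' + inner (g i x) (V + D i x X y) (V' + D i x X' y).
Proof.
move=> hhl [[_ Gsym _ _] hG] Ux.
have split_lift Z W : row_mx Z W =
    hl i x y Z + vlift x y (W + D i x Z y).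
  rewrite (is_hliftE (hhl i x y Z Ux)) vliftE add_row_mx addr0.
  by rewrite addrCA addNr addr0.
have Uz : @cdom R (n + n) (tangent_coords C) i (row_mx x y).
  by rewrite /= row_mxKl.
rewrite (split_lift X) (split_lift X') (inner_Dl _ _ (hl i x y X)).
rewrite !(inner_Dr _ _ (hl i x y X')).
have [-> _ _] := hG i x y (V + D i x X y) (V' + D i x X' y) Ux.
have [_ _ ->] := hG i x y (V + D i x X y) X' Ux.
have [_ -> _] := hG i x y X X' Ux.
rewrite (inner_sym (hl i x y X) _ (Gsym _ _ Uz)).
have [_ _ ->] := hG i x y (V' + D i x X' y) X Ux.
by rewrite addr0 add0r.
Qed.

(** Differentiating the transformation law of the metric produces second
    derivatives of the change of charts, which cancel those in the
    transformation law of the Christoffel symbols. *)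
Lemma cov_metric_trans (g : metric_field C) (D : connection_field C) i j :
  open (overlap i j) -> open (cdom j) -> smooth_on (overlap i j) (trans i j) ->
  (forall x, overlap i j x -> cdom i x /\ cdom j (trans i j x)) ->
  riemannian_metric g -> affine_connection D ->
  forall x u v w, overlap i j x ->
  cov_metric (D i) (g i) x u v w =
  cov_metric (D j) (g j) (trans i j x)
    ('D_u (trans i j) x) ('D_v (trans i j) x) ('D_w (trans i j) x).
Proof.
move=> oO oUj sO domO [gs _ _ gtr] [_ _ _ Dtr] x u v w Ox.
have [Uix Ujx] := domO x Ox; set tau := trans i j in sO Ujx *.
have dtau a : derivable tau x a by have [_ /(_ a)[H _]] := sO 1%N; exact: H.
have d2tau a b : derivable (fun x' => 'D_b tau x') x a.
  by have [_ /(_ b)[_ [_ /(_ a)[H _]]]] := sO 2%N; exact: H.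
have dg a : derivable (g j) (tau x) a.
  by have [_ /(_ a)[H _]] := gs j 1%N; exact: H.
have dgtau : is_derive x u (g j \o tau) ('D_('D_u tau x) (g j) (tau x)).
  apply/is_derive_mxP => a b.
  have Cab := (Ck_on_mxP _ _ oUj).1 (gs j 1%N) a b.
  have := is_derive_chain (derivableP (dtau u))
    (Ck_on_differentiable oUj Cab Ujx).
  by move=> H; apply: (is_derive_eq H); rewrite (derive_mx (dg _)) mxE.
have := is_derive_inner dgtau (derivableP (d2tau u v)) (derivableP (d2tau u w)).
move=> [_ dF].
have -> : cov_metric (D i) (g i) x u v w =
    'D_u (fun x' => inner ((g j \o tau) x') ('D_v tau x') ('D_w tau x') : R^o) x
    - inner (g i x) (D i x u v) w - inner (g i x) v (D i x u w).
  congr (_ - _ - _); apply: near_eq_derive.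
  by apply: filterS (open_nbhs_nbhs (conj oO Ox)) => x' Ox'; exact: gtr.
rewrite dF !(gtr i j x) // -/tau !(Dtr i j x) // -/tau inner_Dl inner_Dr.
rewrite /cov_metric.
have [_ ->] := is_derive_inner (derivableP (dg ('D_u tau x)))
  (is_derive_cst ('D_v tau x) (tau x) ('D_u tau x))
  (is_derive_cst ('D_w tau x) (tau x) ('D_u tau x)).
rewrite inner_0l inner_0r /=; ring.
Qed.

End Sasaki.

(** * A uniform bound on a compact manifold *)

Section Compactness.
Context {R : realType} {n : nat} {M : manifold R n}.
Context {g : metric_field (coords M)} {D : connection_field (coords M)}.

Lemma overlap_open i j : open (@overlap R n (coords M) i j).
Proof.
have -> : @overlap R n (coords M) i j =
    (chart i @` @chart_dom R n M i) `&` (@chart_inv R n M i @^-1` chart_dom j).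
  apply/seteqP; split=> [_ [p [pi pj] <-]|x [[p pi <-]]].
    by split; [exists p|rewrite /= chartK].
  by rewrite /= chartK // => pj; exists p.
rewrite openE => x [xi xj]; apply: filterI.
  by apply: open_nbhs_nbhs; split=> //; exact: chart_image_open.
have cx : chart_inv i x' @[x' --> x] --> chart_inv i x.
  exact: (@chart_inv_continuous R n M i x xi).
apply: cx.
by apply: open_nbhs_nbhs; split=> //; exact: chart_dom_open.
Qed.

(** The quantification over all charts at [p] makes this a property of the
    point alone, to which the compactness of the manifold can be applied. *)
Definition cubic_bound (K : R) (p : M) := forall j, chart_dom j p ->
  let x := chart j p in
  forall X v, cov_metric (D j) (g j) x X v v ^+ 2 <=
    K * inner (g j x) X X * inner (g j x) v v ^+ 2.

(** Near each point a bound holds in one chart, hence in every chart because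
    both sides are tensorial; it persists for larger constants, and finitely
    many such neighbourhoods cover the manifold. *)
Lemma compact_cubic_bound : compact [set: M] -> statistical_structure g D ->
  exists2 K : R, 1 <= K & forall p, cubic_bound K p.
Proof.
move=> cM [rg aD tf Csym].
have [gs gsym gpos gtr] := rg; have [Ds Dl Dr Dtr] := aD.
have oU i : open (@cdom R n (coords M) i) by exact: chart_image_open.
have gpos' i x : cdom i x -> posdef (g i x) by move=> Ux v; exact: gpos.
have : \forall K \near +oo, [set: M] `<=` cubic_bound K.
  apply: (compact_near_coveringP _).1 => // p _.
  have [i pi] := chart_cover p.
  have Ux0 : @cdom R n (coords M) i (chart i p) by exists p.
  have [K0 K00 HK0] := cov_metric_locally_bounded (oU i) (gs i) (gsym i)
    (gpos' i) (Ds i) (Dr i) (Csym i) Ux0.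
  have np : \forall p' \near p, chart_dom i p' /\
      forall X v, cov_metric (D i) (g i) (chart i p') X v v ^+ 2 <=
        K0 * inner (g i (chart i p')) X X * inner (g i (chart i p')) v v ^+ 2.
    have cp : chart i p' @[p' --> p] --> chart i p.
      exact: (@chart_continuous R n M i p pi).
    have n1 : nbhs p (chart_dom i).
      by apply: open_nbhs_nbhs; split=> //; exact: chart_dom_open.
    have n2 := cp _ HK0.
    by move: n1 n2; apply: filterS2 => p' ? [].
  have nK : \forall K \near +oo, K0 <= K.
    by apply: nbhs_pinfty_ge; exact: num_real.
  near=> p' K => /=.
  have [p'i Hi] : chart_dom i p' /\ forall X v,
     cov_metric (D i) (g i) (chart i p') X v v ^+ 2 <=
        K0 * inner (g i (chart i p')) X X * inner (g i (chart i p')) v v ^+ 2.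
    by near: p'.
  have KK : K0 <= K by near: K.
  move=> j p'j /= X v.
  have Ox : @overlap R n (coords M) j i (chart j p') by exists p'.
  have tx : @trans R n (coords M) j i (chart j p') = chart i p'.
    by rewrite /= chartK.
  have domO x : @overlap R n (coords M) j i x ->
      @cdom R n (coords M) j x /\
      @cdom R n (coords M) i (@trans R n (coords M) j i x).
    move=> [q [qj qi] <-]; split; first by exists q.
    by rewrite /= chartK //; exists q.
  rewrite (cov_metric_trans (@overlap_open j i) (oU i) _ domO rg aD) //;
    last exact: chart_smooth.
  rewrite !(gtr j i (chart j p')) // tx; apply: le_trans (Hi _ _) _.
  have Ui : @cdom R n (coords M) i (chart i p') by exists p'.
  rewrite ler_wpM2r ?sqr_ge0 // ler_wpM2r //; exact: posdef_ge0 (gpos' _ _ Ui).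
move=> HK.
have [K [K1 bK]] : exists K : R, 1 <= K /\ [set: M] `<=` cubic_bound K.
  have n1 : \forall K \near +oo, 1 <= K :> R.
    by apply: nbhs_pinfty_ge; exact: num_real.
  exact: filter_ex (filterI n1 HK).
by exists K => // p; exact: bK.
Unshelve. all: by end_near. Qed.

End Compactness.

(* Dimension 1 is excluded: on a flat circle, S^rM consists of two geodesics
   of a flat cylinder, whose second fundamental form vanishes for every r.
   hl is the horizontal lift, G the Sasakian metric on TM and DG the
   Levi-Civita connection of G. *)
Theorem theorem3p6 (R : realType) (n : nat) (hn : n <> 1%N)
  (M : manifold R n) (hM : compact [set: M])
  (g : metric_field (coords M)) (D : connection_field (coords M))
  (hgD : statistical_structure g D)
  (hl : cindex (coords M) -> 'rV[R]_n -> 'rV[R]_n -> 'rV[R]_n -> 'rV[R]_(n + n))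
  (hhl : horizontal_lift D hl)
  (G : metric_field (tangent_coords (coords M)))
  (hG : sasakian_metric g hl G)
  (DG : connection_field (tangent_coords (coords M)))
  (hDG : levi_civita G DG) :
  forall L : R, exists2 r : R, 0 < r &
    forall (i : cindex (coords M)) (z : 'rV[R]_(n + n)),
      sphere_bundle g r i z ->
      forall (N : 'rV[R]_(n + n)) (h : 'rV[R]_(n + n) -> 'rV[R]_(n + n) -> R)
             (k : nat) (e : 'I_k -> 'rV[R]_(n + n)),
        unit_normal (G i) (sphere_bundle g r i) z N ->
        second_fundamental_form (G i) (DG i)
          (sphere_bundle g r i) z N h ->
        orthonormal_basis (G i z)
          (tangent_space (sphere_bundle g r i) z) e ->
        L < tensor_norm e h.
Proof.
move=> L; have [K K1 HK] := compact_cubic_bound hM hgD.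
(* With r = 1 / (2 a) the lower bound 1 / (2 r) - K equals a - K. *)
pose a := K + `|L| + 1; have a1 : 1 <= a.
  by rewrite /a; have := normr_ge0 L; lra.
have La : L + K < a by rewrite /a; have := ler_norm L; lra.
have Ka : K <= a by rewrite /a; have := normr_ge0 L; lra.
exists (2 * a)^-1; first by rewrite invr_gt0; lra.
move=> i z; rewrite -[z]hsubmxK; set x := lsubmx z; set y := rsubmx z.
move=> [/=]; rewrite row_mxKl row_mxKr => Ux yr N h k e uN hh he.
have [rg aD tf Csym] := hgD.
have [gs gsym gpos gtr] := rg; have [Ds Dl Dr Dtr] := aD.
have [[Gs Gsym Gpos Gtr] _] := hG; have [aDG tDG DGm] := hDG.
have r0 : 0 < (2 * a)^-1 by rewrite invr_gt0; lra.
apply: (@tensor_norm_lower_bound R n (@cdom R n (coords M) i) (g i) (D i)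
  (G i) (DG i) _ (gs i) (gsym i) _ (Dl i) (Dr i) _ (Gsym i) (DGm i) (tDG i)
  x y (2 * a)^-1 N Ux r0 yr uN hn h k e K L hh he) => //.
- exact: chart_image_open.
- by move=> x' Ux' v; exact: gpos.
- by move=> x' y' X V X' V';
  exact: (@sasakian_metricE R n (coords M) g D hl G i x' y' X V X' V' hhl hG).
- by case: Ux => p pi xp X v; rewrite -xp; exact: (HK p).
- rewrite expr2 mulrA; apply: (@le_trans _ _ (1 * (2 * a)^-1)).
    rewrite ler_wpM2r ?(ltW r0) // ler_pdivrMr ?mul1r; lra.
  by rewrite mul1r invf_le1; lra.
- have -> : (2 * (2 * a)^-1)^-1 = a by field; rewrite gt_eqF //; lra.
  exact: La.
Qed.
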